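(* Let $\mathcal X_{\mathcal Q_3}^{1/3}$ be the quantum torus described in the context, and write $T=Z_{111}^{(t)}$, $B=Z_{111}^{(b)}$. Let $\overline C,\overline Y\in\mathrm{Mat}_3(\mathcal X_{\mathcal Q_3}^{1/3})$ be the (invertible) triangular matrices $$\overline C=\begin{pmatrix}c_1&\overline C_{12}&\overline C_{13}\\0&c_2&\overline C_{23}\\0&0&c_3\end{pmatrix},\qquad \overline Y=\begin{pmatrix}y_3&0&0\\\overline Y_{21}&y_2&0\\\overline Y_{31}&\overline Y_{32}&y_1\end{pmatrix}$$ with entries given in the context, and let $\overline R=q^{2/3}(\overline C\,\overline Y)^{-1}$. Let also $$c_1=Z_{C1}^{1/3}Z_{C2}^{2/3}Z_{Y3}^{2/3}Z_{C3}^{1/3}T^{2/3}B^{2/3},\quad c_2=Z_{C1}^{1/3}Z_{C2}^{-1/3}Z_{Y3}^{-1/3}Z_{C3}^{1/3}T^{-1/3}B^{-1/3},\quad c_3=Z_{C1}^{-2/3}Z_{C2}^{-1/3}Z_{Y3}^{-1/3}Z_{C3}^{-2/3}T^{-1/3}B^{-1/3},$$ $$y_1=Z_{Y1}^{1/3}Z_{Y2}^{2/3}Z_{Y3}^{1/3}Z_{C3}^{2/3}T^{2/3}B^{2/3},\quad y_2=Z_{Y1}^{1/3}Z_{Y2}^{-1/3}Z_{Y3}^{1/3}Z_{C3}^{-1/3}T^{-1/3}B^{-1/3},\quad y_3=Z_{Y1}^{-2/3}Z_{Y2}^{-1/3}Z_{Y3}^{-2/3}Z_{C3}^{-1/3}T^{-1/3}B^{-1/3},$$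 $$r_1=Z_{Y1}^{2/3}Z_{Y2}^{1/3}Z_{C1}^{2/3}Z_{C2}^{1/3}T^{2/3}B^{2/3},\quad r_2=Z_{Y1}^{-1/3}Z_{Y2}^{1/3}Z_{C1}^{-1/3}Z_{C2}^{1/3}T^{-1/3}B^{-1/3},\quad r_3=Z_{Y1}^{-1/3}Z_{Y2}^{-2/3}Z_{C1}^{-1/3}Z_{C2}^{-2/3}T^{-1/3}B^{-1/3}.$$ Then: (i) the nine elements $c_i,y_i,r_i$ are central in $\mathcal X_{\mathcal Q_3}^{1/3}$; (ii) with $\mathbb 1$ the identity matrix, $$(\overline C-c_1\mathbb 1)(\overline C-c_2\mathbb 1)(\overline C-c_3\mathbb 1)=0,\quad(\overline Y-y_1\mathbb 1)(\overline Y-y_2\mathbb 1)(\overline Y-y_3\mathbb 1)=0,\quad(\overline R-r_1\mathbb 1)(\overline R-r_2\mathbb 1)(\overline R-r_3\mathbb 1)=0,$$ and $\overline C\,\overline Y\,\overline R=q^{2/3}\mathbb 1$; (iii) the assignment $J_1\mapsto\overline C$, $J_2\mapsto\overline Y$, $J_3\mapsto\overline R$, $q\mapsto q^{-2}$ (that is, $q^{1/3}\mapsto q^{-2/3}$), with $t_1^{(j)}\mapsto c_j\mathbb 1$, $t_2^{(j)}\mapsto y_j\mathbb 1$, $t_3^{(j)}\mapsto r_j\mathbb 1$ for $j=1,2$, defines an injective algebra homomorphism of the universal algebra $\mathsf H_{E_6}$ into $\mathrm{Mat}_3(\mathcal X_{\mathcal Q_3}^{1/3})$.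
   Context: Universal algebra: $\mathsf H_{E_6}$ is the algebra over $\mathbb C[(t_i^{(j)})^{\pm1}:i=1,2,3,\,j=1,2]\otimes\mathbb C[q^{\pm1/3}]$ (all these parameters being central) generated by $J_1,J_2,J_3$ with relations $(J_i-t_i^{(1)})(J_i-t_i^{(2)})\big(J_i-\tfrac{1}{t_i^{(1)}t_i^{(2)}}\big)=0$, $i=1,2,3$, and $J_1J_2J_3=q^{-1/3}$. Quantum torus: the quiver $\mathcal Q_3$ has eight vertices $Z_{Y1},Z_{Y2},Z_{Y3},Z_{C1},Z_{C2},Z_{C3},T,B$ (where $T=Z_{111}^{(t)}$, $B=Z_{111}^{(b)}$) and exactly the arrows $T\to Z$ and $Z\to B$ for $Z\in\{Z_{Y2},Z_{Y3},Z_{C1}\}$, and $B\to Z$ and $Z\to T$ for $Z\in\{Z_{Y1},Z_{C2},Z_{C3}\}$. With $q$ a central invertible indeterminate, $\mathcal X_{\mathcal Q_3}^{1/3}$ is the $\mathbb C[q^{\pm1/18}]$-algebra generated by invertible elements $Z_\alpha^{1/3}$, one per vertex $\alpha$, with relations $Z_\beta^{1/3}Z_\alpha^{1/3}=q^{-2/9}Z_\alpha^{1/3}Z_\beta^{1/3}$ whenever there is an arrow $\alpha\to\beta$, and $Z_\beta^{1/3}Z_\alpha^{1/3}=Z_\alpha^{1/3}Z_\beta^{1/3}$ whenever there is no arrow between $\alpha$ and $\beta$. We write $Z_\alpha^{k/3}=(Z_\alpha^{1/3})^k$. (So $Z_\beta Z_\alpha=q^{-2}Z_\alpha Z_\beta$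 for an arrow $\alpha\to\beta$.) Off-diagonal entries (products in the order written): $$\overline C_{12}=-q^{1/3}Z_{C1}^{1/3}Z_{C2}^{-1/3}Z_{Y3}^{-1/3}Z_{C3}^{1/3}T^{-1/3}B^{-1/3}-Z_{C1}^{1/3}\big(Z_{C2}^{-1/3}+q^{-1}Z_{C2}^{2/3}\big)Z_{Y3}^{-1/3}Z_{C3}^{1/3}T^{2/3}B^{-1/3}-Z_{C1}^{1/3}Z_{C2}^{2/3}Z_{Y3}^{-1/3}Z_{C3}^{1/3}T^{2/3}B^{2/3},$$ $$\overline C_{13}=\big(Z_{C1}^{1/3}+q^{1/3}Z_{C1}^{-2/3}\big)Z_{C2}^{-1/3}Z_{Y3}^{-1/3}Z_{C3}^{-2/3}T^{-1/3}B^{-1/3}+Z_{C1}^{1/3}\big(q^{5/3}Z_{C2}^{-1/3}+q^{2/3}Z_{C2}^{2/3}\big)Z_{Y3}^{-1/3}Z_{C3}^{-2/3}T^{2/3}B^{-1/3},$$ $$\overline C_{23}=-\big(q^{-1/3}Z_{C1}^{1/3}+Z_{C1}^{-2/3}\big)Z_{C2}^{-1/3}Z_{Y3}^{-1/3}Z_{C3}^{-2/3}T^{-1/3}B^{-1/3},$$ $$\overline Y_{21}=\big(q^{-1/3}Z_{Y1}^{1/3}+Z_{Y1}^{-2/3}\big)Z_{Y2}^{-1/3}Z_{Y3}^{1/3}Z_{C3}^{-1/3}T^{-1/3}B^{-1/3},$$ $$\overline Y_{31}=\big(Z_{Y1}^{1/3}+q^{1/3}Z_{Y1}^{-2/3}\big)Z_{Y2}^{-1/3}Z_{Y3}^{1/3}Z_{C3}^{2/3}T^{-1/3}B^{-1/3}+Z_{Y1}^{1/3}\big(qZ_{Y2}^{-1/3}+Z_{Y2}^{2/3}\big)Z_{Y3}^{1/3}Z_{C3}^{2/3}T^{-1/3}B^{2/3},$$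 $$\overline Y_{32}=q^{1/3}Z_{Y1}^{1/3}Z_{Y2}^{-1/3}Z_{Y3}^{1/3}Z_{C3}^{2/3}T^{-1/3}B^{-1/3}+Z_{Y1}^{1/3}\big(q^{4/3}Z_{Y2}^{-1/3}+q^{1/3}Z_{Y2}^{2/3}\big)Z_{Y3}^{1/3}Z_{C3}^{2/3}T^{-1/3}B^{2/3}+Z_{Y1}^{1/3}Z_{Y2}^{2/3}Z_{Y3}^{1/3}Z_{C3}^{2/3}T^{2/3}B^{2/3}.$$ *)

(* Defs.v *)
From HB Require Import structures.
From mathcomp Require Import all_boot all_order all_algebra.
From mathcomp Require Import generic_quotient complex.
From mathcomp Require Import boolp reals.

Set Implicit Arguments.
Unset Strict Implicit.
Unset Printing Implicit Defensive.

Import GRing.Theory.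

Declare Scope presentation_scope.
Delimit Scope presentation_scope with pres.
Local Open Scope ring_scope.
Local Open Scope quotient_scope.

(** * Unital associative algebras presented by generators and relations *)

Inductive pterm (K G : Type) : Type :=
| Gen of G
| Cst of K
| Add of pterm K G & pterm K G
| Mul of pterm K G & pterm K G.

Arguments Gen {K G} _.
Arguments Cst {K G} _%_R.
Bind Scope presentation_scope with pterm.

Notation "s + t" := (Add s t) : presentation_scope.
Notation "s * t" := (Mul s t) : presentation_scope.
Notation "s - t" := (Add s (Mul (Cst (-1)) t)) : presentation_scope.

HB.instance Definition _ (K G : Type) := gen_eqMixin (pterm K G).
HB.instance Definition _ (K G : Type) := gen_choiceMixin (pterm K G).

Section Presented.
Variables (K : comNzRingType) (G : Type).
Variable rel : pterm K G -> pterm K G -> Prop.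

(* The smallest congruence containing [rel] for which the quotient is an
   associative unital K-algebra with k . s = Cst k * s. *)
Inductive cong : pterm K G -> pterm K G -> Prop :=
| cong_refl s : cong s s
| cong_sym s t : cong s t -> cong t s
| cong_trans s t u : cong s t -> cong t u -> cong s u
| cong_add s s' t t' : cong s s' -> cong t t' -> cong (s + t) (s' + t')
| cong_mul s s' t t' : cong s s' -> cong t t' -> cong (s * t) (s' * t')
| cong_addA s t u : cong (s + (t + u)) (s + t + u)
| cong_addC s t : cong (s + t) (t + s)
| cong_add0 s : cong (Cst 0 + s) s
| cong_addN s : cong (Cst (-1) * s + s) (Cst 0)
| cong_mulA s t u : cong (s * (t * u)) (s * t * u)
| cong_mul1 s : cong (Cst 1 * s) s
| cong_mulDl s t u : cong ((s + t) * u) (s * u + t * u)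
| cong_mulDr s t u : cong (s * (t + u)) (s * t + s * u)
| cong_CstD a b : cong (Cst (a + b)) (Cst a + Cst b)
| cong_CstM a b : cong (Cst (a * b)) (Cst a * Cst b)
| cong_CstC a s : cong (Cst a * s) (s * Cst a)
| cong_rel s t : rel s t -> cong s t.

Definition congb (s t : pterm K G) : bool := `[< cong s t >].

Fact congb_equiv : equiv_class_of congb.
Proof.
split.
- by move=> s; apply/asboolP/cong_refl.
- by move=> s t; apply/asboolP/asboolP; apply: cong_sym.
- by move=> t s u /asboolP st /asboolP tu; apply/asboolP/(cong_trans st).
Qed.

Canonical cong_equiv := EquivRelPack congb_equiv.

Definition presented := {eq_quot cong_equiv}.

HB.instance Definition _ := Choice.on presented.
HB.instance Definition _ := EqQuotient.on presented.

Definition pclass (s : pterm K G) : presented := \pi_presented s.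
Definition pgen (g : G) : presented := pclass (Gen g).

Lemma pclassP s t : pclass s = pclass t <-> cong s t.
Proof.
split=> [/eqP|st]; first by rewrite /pclass eqmodE => /asboolP.
by apply/eqP; rewrite /pclass eqmodE; apply/asboolP.
Qed.

Lemma pclassK x : pclass (repr x) = x.
Proof. exact: reprK. Qed.

Lemma presented_ind (P : presented -> Prop) :
  (forall s, P (pclass s)) -> forall x, P x.
Proof. by move=> H x; rewrite -(pclassK x). Qed.

Lemma cong_repr s : cong (repr (pclass s)) s.
Proof. by apply/pclassP; rewrite pclassK. Qed.

Definition padd (x y : presented) := pclass (repr x + repr y).
Definition pmul (x y : presented) := pclass (repr x * repr y).
Definition popp (x : presented) := pclass (Cst (-1) * repr x).
Definition pscale (a : K) (x : presented) := pclass (Cst a * repr x).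

Lemma paddE s t : padd (pclass s) (pclass t) = pclass (s + t).
Proof. by apply/pclassP/cong_add; apply: cong_repr. Qed.

Lemma pmulE s t : pmul (pclass s) (pclass t) = pclass (s * t).
Proof. by apply/pclassP/cong_mul; apply: cong_repr. Qed.

Lemma poppE s : popp (pclass s) = pclass (Cst (-1) * s).
Proof. by apply/pclassP/cong_mul/cong_repr/cong_refl. Qed.

Lemma pscaleE a s : pscale a (pclass s) = pclass (Cst a * s).
Proof. by apply/pclassP/cong_mul/cong_repr/cong_refl. Qed.

Fact paddA : associative padd.
Proof.
do 3![elim/presented_ind => ?]; rewrite !paddE.
exact/pclassP/cong_addA.
Qed.

Fact paddC : commutative padd.
Proof.
do 2![elim/presented_ind => ?]; rewrite !paddE.
exact/pclassP/cong_addC.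
Qed.

Fact padd0 : left_id (pclass (Cst 0)) padd.
Proof. by elim/presented_ind => s; rewrite paddE; apply/pclassP/cong_add0. Qed.

Fact paddN : left_inverse (pclass (Cst 0)) popp padd.
Proof.
by elim/presented_ind => s; rewrite poppE paddE; apply/pclassP/cong_addN.
Qed.

HB.instance Definition _ :=
  GRing.isZmodule.Build presented paddA paddC padd0 paddN.

Fact pmulA : associative pmul.
Proof.
do 3![elim/presented_ind => ?]; rewrite !pmulE.
exact/pclassP/cong_mulA.
Qed.

Fact pmul1 : left_id (pclass (Cst 1)) pmul.
Proof. by elim/presented_ind => s; rewrite pmulE; apply/pclassP/cong_mul1. Qed.

Fact pmulr1 : right_id (pclass (Cst 1)) pmul.
Proof.
elim/presented_ind => s; rewrite pmulE; apply/pclassP.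
exact: cong_trans (cong_sym (cong_CstC 1 s)) (cong_mul1 s).
Qed.

Fact pmulDl : left_distributive pmul padd.
Proof.
do 3![elim/presented_ind => ?]; rewrite !(paddE, pmulE).
exact/pclassP/cong_mulDl.
Qed.

Fact pmulDr : right_distributive pmul padd.
Proof.
do 3![elim/presented_ind => ?]; rewrite !(paddE, pmulE).
exact/pclassP/cong_mulDr.
Qed.

HB.instance Definition _ :=
  GRing.Zmodule_isPzRing.Build presented pmulA pmul1 pmulr1 pmulDl pmulDr.

Fact pscaleA a b x : pscale a (pscale b x) = pscale (a * b) x.
Proof.
elim/presented_ind: x => s; rewrite !pscaleE; apply/pclassP.
apply: cong_trans (cong_mulA _ _ _) _.
exact: cong_mul (cong_sym (cong_CstM a b)) (cong_refl s).
Qed.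

Fact pscale1 : left_id 1 pscale.
Proof. by elim/presented_ind => s; rewrite pscaleE; apply/pclassP/cong_mul1. Qed.

Fact pscaleDr : right_distributive pscale +%R.
Proof.
move=> a; elim/presented_ind => s; elim/presented_ind => t.
rewrite [X in pscale a X]paddE !pscaleE [RHS]paddE.
exact/pclassP/cong_mulDr.
Qed.

Fact pscaleDl x : {morph pscale^~ x : a b / a + b}.
Proof.
move=> a b; elim/presented_ind: x => s; rewrite !pscaleE [RHS]paddE.
apply/pclassP; apply: cong_trans (cong_mulDl _ _ _).
exact: cong_mul (cong_CstD a b) (cong_refl s).
Qed.

HB.instance Definition _ := GRing.Zmodule_isLmodule.Build K presented
  pscaleA pscale1 pscaleDr pscaleDl.

Lemma pclassD s t : pclass (s + t) = pclass s + pclass t.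
Proof. by rewrite -paddE. Qed.

Lemma pclassM s t : pclass (s * t) = pclass s * pclass t.
Proof. by rewrite -pmulE. Qed.

Lemma pclass0 : pclass (Cst 0) = 0. Proof. by []. Qed.

Lemma pclass1 : pclass (Cst 1) = 1. Proof. by []. Qed.

Lemma pclassCst a : pclass (Cst a) = a *: (1 : presented).
Proof.
rewrite -pclass1 [RHS]pscaleE; apply/pclassP.
exact: cong_trans (cong_sym (cong_mul1 _)) (cong_CstC _ _).
Qed.

Fact pscaleAl a (x y : presented) : a *: (x * y) = (a *: x) * y.
Proof.
elim/presented_ind: x => s; elim/presented_ind: y => t.
rewrite -pclassM ![_ *: _]pscaleE -pclassM; apply/pclassP/cong_mulA.
Qed.

Fact pscaleAr a (x y : presented) : a *: (x * y) = x * (a *: y).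
Proof.
elim/presented_ind: x => s; elim/presented_ind: y => t.
rewrite -pclassM ![_ *: _]pscaleE -pclassM; apply/pclassP.
apply: cong_trans (cong_mulA _ _ _) _; apply: cong_trans (cong_sym (cong_mulA _ _ _)).
exact: cong_mul (cong_CstC _ _) (cong_refl _).
Qed.

Section Lift.
Variables (A : pzRingType) (f : {rmorphism K -> A}) (g : G -> A).

Fixpoint eval (s : pterm K G) : A :=
  match s with
  | Gen x => g x
  | Cst a => f a
  | Add s t => eval s + eval t
  | Mul s t => eval s * eval t
  end.

Hypothesis f_central : forall a x, f a * x = x * f a.
Hypothesis eval_rel : forall s t, rel s t -> eval s = eval t.

Lemma eval_cong s t : cong s t -> eval s = eval t.
Proof.
elim=> //=.
- by move=> ? ? ? _ -> _ ->.
- by move=> ? ? ? ? _ -> _ ->.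
- by move=> ? ? ? ? _ -> _ ->.
- by move=> *; rewrite addrA.
- by move=> *; rewrite addrC.
- by move=> *; rewrite rmorph0 add0r.
- by move=> *; rewrite rmorphN1 mulN1r addNr rmorph0.
- by move=> *; rewrite mulrA.
- by move=> *; rewrite rmorph1 mul1r.
- by move=> *; rewrite mulrDl.
- by move=> *; rewrite mulrDr.
- by move=> *; rewrite rmorphD.
- by move=> *; rewrite rmorphM.
Qed.

Definition lift (x : presented) : A := eval (repr x).

Lemma lift_class s : lift (pclass s) = eval s.
Proof. exact/eval_cong/cong_repr. Qed.

Fact lift_zmod_morphism : zmod_morphism lift.
Proof.
do 2![elim/presented_ind => ?]; rewrite [in LHS]/GRing.opp /= poppE -pclassD.
by rewrite !lift_class /= rmorphN1 mulN1r.
Qed.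

Fact lift_monoid_morphism : monoid_morphism lift.
Proof.
split; first by rewrite -pclass1 lift_class /= rmorph1.
by do 2![elim/presented_ind => ?]; rewrite -pclassM !lift_class.
Qed.

Lemma lift_rmorphism : exists h : {rmorphism presented -> A},
  (forall x, h (pgen x) = g x) /\ (forall a, h (a *: (1 : presented)) = f a).
Proof.
pose am := GRing.isZmodMorphism.Build _ _ lift lift_zmod_morphism.
pose mm := GRing.isMonoidMorphism.Build _ _ lift lift_monoid_morphism.
pose h : {rmorphism presented -> A} := HB.pack lift am mm.
exists h; split=> [x|a]; first exact: lift_class.
by rewrite -pclassCst; apply: lift_class.
Qed.

End Lift.
End Presented.

(** * Laurent polynomials *)

(* [Pos i] and [Neg i] are a formal invertible generator and its inverse. *)
Inductive invgen (I : Type) : Type := Pos of I | Neg of I.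

(* [ipow x y k] is x ^ k, where y is the inverse of x. *)
Definition ipow (A : pzRingType) (x y : A) (k : int) : A :=
  match k with Posz n => x ^+ n | Negz n => y ^+ n.+1 end.
Arguments ipow {A} x y k%_Z.

Section Laurent.
Variables (K : comNzRingType) (I : Type).

Inductive laurent_rel :
    pterm K (invgen I) -> pterm K (invgen I) -> Prop :=
| laurent_comm s t : laurent_rel (s * t) (t * s)
| laurent_inv i : laurent_rel (Gen (Pos i) * Gen (Neg i)) (Cst 1).

Definition laurent := presented laurent_rel.

HB.instance Definition _ := GRing.PzRing.on laurent.
HB.instance Definition _ := GRing.Lmodule.on laurent.

Lemma laurent_one_morph : exists h : {rmorphism laurent -> K},
  forall i, h (pgen _ i) = 1.
Proof.
have [|s t|h [h1 _]] := @lift_rmorphism K _ laurent_rel K idfun (fun=> 1).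
- by move=> a x; rewrite mulrC.
- by case=> [{}s {}t|i] /=; rewrite ?mulr1 // mulrC.
- by exists h.
Qed.

Fact laurent_mulC : commutative (@GRing.mul laurent).
Proof.
do 2![elim/presented_ind => ?]; rewrite -!pclassM.
exact/pclassP/cong_rel/laurent_comm.
Qed.

HB.instance Definition _ :=
  GRing.PzRing_hasCommutativeMul.Build laurent laurent_mulC.

Fact laurent_neq0 : (1 : laurent) != 0.
Proof.
have [h _] := laurent_one_morph; apply/eqP => /(congr1 h) /eqP.
by rewrite rmorph1 rmorph0 oner_eq0.
Qed.

HB.instance Definition _ :=
  GRing.PzSemiRing_isNonZero.Build laurent laurent_neq0.
HB.instance Definition _ := GRing.Lmodule_isLalgebra.Build K laurent
  (@pscaleAl _ _ laurent_rel).
HB.instance Definition _ := GRing.Lalgebra_isAlgebra.Build K laurent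
  (@pscaleAr _ _ laurent_rel).

(* the monomial u_i ^ k *)
Definition lvar (i : I) (k : int) : laurent :=
  ipow (pgen laurent_rel (Pos i)) (pgen laurent_rel (Neg i)) k.

End Laurent.

Arguments lvar {K I} i k%_Z.

(** * The universal algebra H_{E_6} *)

(* The central parameters: [Pq3] is q^{1/3}, and [Pt i j] is t_{i+1}^{(j+1)}
   (ordinals are numbered from 0). *)
Inductive E6_param : Type := Pq3 | Pt of 'I_3 & 'I_2.

Section HE6.
Variable R : realType.

Definition E6_base := laurent R[i] E6_param.
HB.instance Definition _ := GRing.ComAlgebra.on E6_base.

Definition E6_t (i : 'I_3) (j : 'I_2) (k : int) : E6_base := lvar (Pt i j) k.
Definition E6_q3 (k : int) : E6_base := lvar Pq3 k.
Arguments E6_t i j k%_Z.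
Arguments E6_q3 k%_Z.

Inductive E6_rel : pterm E6_base 'I_3 -> pterm E6_base 'I_3 -> Prop :=
| E6_hecke i : E6_rel
    ((Gen i - Cst (E6_t i 0 1)) * (Gen i - Cst (E6_t i 1 1))
       * (Gen i - Cst (E6_t i 0 (-1) * E6_t i 1 (-1))))
    (Cst 0)
| E6_prod : E6_rel (Gen 0 * Gen 1 * Gen 2) (Cst (E6_q3 (-1))).

Definition HE6 := presented E6_rel.

HB.instance Definition _ := GRing.PzRing.on HE6.
HB.instance Definition _ := GRing.Lmodule.on HE6.

Fact HE6_neq0 : (1 : HE6) != 0.
Proof.
have [h h1] := @laurent_one_morph R[i] E6_param.
have [|s t|H _] := @lift_rmorphism _ _ E6_rel R[i] h (fun=> 1).
- by move=> a x; rewrite mulrC.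
- case=> [i|] /=; rewrite ?rmorphM ?rmorphN1 ?rmorph0 !h1 ?mulr1 //.
  by rewrite subrr !mulr0.
- apply/eqP => /(congr1 H) /eqP.
  by rewrite rmorph1 rmorph0 oner_eq0.
Qed.

HB.instance Definition _ := GRing.PzSemiRing_isNonZero.Build HE6 HE6_neq0.
HB.instance Definition _ := GRing.Lmodule_isLalgebra.Build E6_base HE6
  (@pscaleAl _ _ E6_rel).
HB.instance Definition _ := GRing.Lalgebra_isAlgebra.Build E6_base HE6
  (@pscaleAr _ _ E6_rel).

Definition E6_J (i : 'I_3) : HE6 := pgen E6_rel i.

End HE6.

(** * The quantum torus of the quiver Q_3 *)

Inductive vertex : Type := ZY1 | ZY2 | ZY3 | ZC1 | ZC2 | ZC3 | ZT | ZB.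

Definition arrow (a b : vertex) : bool :=
  match a, b with
  | ZT, (ZY2 | ZY3 | ZC1) | (ZY2 | ZY3 | ZC1), ZB
  | ZB, (ZY1 | ZC2 | ZC3) | (ZY1 | ZC2 | ZC3), ZT => true
  | _, _ => false
  end.

Section QuantumTorus.
Variable R : realType.

(* C[q^{1/18}, q^{-1/18}], with [q18 k] = q^{k/18} *)
Definition qring := laurent R[i] unit.
HB.instance Definition _ := GRing.ComAlgebra.on qring.

Definition q18 (k : int) : qring := lvar tt k.
Arguments q18 k%_Z.

Inductive torus_rel :
    pterm qring (invgen vertex) -> pterm qring (invgen vertex) -> Prop :=
| torus_invr a : torus_rel (Gen (Pos a) * Gen (Neg a)) (Cst 1)
| torus_invl a : torus_rel (Gen (Neg a) * Gen (Pos a)) (Cst 1)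
| torus_arrow a b : arrow a b -> torus_rel
    (Gen (Pos b) * Gen (Pos a)) (Cst (q18 (-4)) * (Gen (Pos a) * Gen (Pos b)))
| torus_noarrow a b : ~~ arrow a b -> ~~ arrow b a -> torus_rel
    (Gen (Pos b) * Gen (Pos a)) (Gen (Pos a) * Gen (Pos b)).

Definition torus := presented torus_rel.

HB.instance Definition _ := GRing.PzRing.on torus.
HB.instance Definition _ := GRing.Lmodule.on torus.

Fact torus_neq0 : (1 : torus) != 0.
Proof.
have [h h1] := @laurent_one_morph R[i] unit.
have [|s t|H _] := @lift_rmorphism _ _ torus_rel R[i] h (fun=> 1).
- by move=> a x; rewrite mulrC.
- by case=> [a|a|a b _|a b _ _] /=; rewrite ?rmorph1 ?rmorphXn ?h1 ?expr1n ?mulr1.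
- apply/eqP => /(congr1 H) /eqP.
  by rewrite rmorph1 rmorph0 oner_eq0.
Qed.

HB.instance Definition _ := GRing.PzSemiRing_isNonZero.Build torus torus_neq0.
HB.instance Definition _ := GRing.Lmodule_isLalgebra.Build qring torus
  (@pscaleAl _ _ torus_rel).
HB.instance Definition _ := GRing.Lalgebra_isAlgebra.Build qring torus
  (@pscaleAr _ _ torus_rel).

(* [Z a k] is Z_a^{k/3} and [q3 k] is q^{k/3} *)
Definition Z (a : vertex) (k : int) : torus :=
  ipow (pgen torus_rel (Pos a)) (pgen torus_rel (Neg a)) k.
Arguments Z a k%_Z.

Definition q3 (k : int) : torus := (q18 (6 * k))%:A.
Arguments q3 k%_Z.

Definition mx3 (rows : seq (seq torus)) : 'M[torus]_3 :=
  \matrix_(i < 3, j < 3) (nth [::] rows i)`_j.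

Definition c1 : torus := Z ZC1 1 * Z ZC2 2 * Z ZY3 2 * Z ZC3 1 * Z ZT 2 * Z ZB 2.
Definition c2 : torus :=
  Z ZC1 1 * Z ZC2 (-1) * Z ZY3 (-1) * Z ZC3 1 * Z ZT (-1) * Z ZB (-1).
Definition c3 : torus :=
  Z ZC1 (-2) * Z ZC2 (-1) * Z ZY3 (-1) * Z ZC3 (-2) * Z ZT (-1) * Z ZB (-1).

Definition y1 : torus := Z ZY1 1 * Z ZY2 2 * Z ZY3 1 * Z ZC3 2 * Z ZT 2 * Z ZB 2.
Definition y2 : torus :=
  Z ZY1 1 * Z ZY2 (-1) * Z ZY3 1 * Z ZC3 (-1) * Z ZT (-1) * Z ZB (-1).
Definition y3 : torus :=
  Z ZY1 (-2) * Z ZY2 (-1) * Z ZY3 (-2) * Z ZC3 (-1) * Z ZT (-1) * Z ZB (-1).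

Definition r1 : torus := Z ZY1 2 * Z ZY2 1 * Z ZC1 2 * Z ZC2 1 * Z ZT 2 * Z ZB 2.
Definition r2 : torus :=
  Z ZY1 (-1) * Z ZY2 1 * Z ZC1 (-1) * Z ZC2 1 * Z ZT (-1) * Z ZB (-1).
Definition r3 : torus :=
  Z ZY1 (-1) * Z ZY2 (-2) * Z ZC1 (-1) * Z ZC2 (-2) * Z ZT (-1) * Z ZB (-1).

Definition C12 : torus :=
  - (q3 1 * Z ZC1 1 * Z ZC2 (-1) * Z ZY3 (-1) * Z ZC3 1 * Z ZT (-1) * Z ZB (-1))
  - Z ZC1 1 * (Z ZC2 (-1) + q3 (-3) * Z ZC2 2)
      * Z ZY3 (-1) * Z ZC3 1 * Z ZT 2 * Z ZB (-1)
  - Z ZC1 1 * Z ZC2 2 * Z ZY3 (-1) * Z ZC3 1 * Z ZT 2 * Z ZB 2.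

Definition C13 : torus :=
  (Z ZC1 1 + q3 1 * Z ZC1 (-2))
      * Z ZC2 (-1) * Z ZY3 (-1) * Z ZC3 (-2) * Z ZT (-1) * Z ZB (-1)
  + Z ZC1 1 * (q3 5 * Z ZC2 (-1) + q3 2 * Z ZC2 2)
      * Z ZY3 (-1) * Z ZC3 (-2) * Z ZT 2 * Z ZB (-1).

Definition C23 : torus :=
  - ((q3 (-1) * Z ZC1 1 + Z ZC1 (-2))
      * Z ZC2 (-1) * Z ZY3 (-1) * Z ZC3 (-2) * Z ZT (-1) * Z ZB (-1)).

Definition Y21 : torus :=
  (q3 (-1) * Z ZY1 1 + Z ZY1 (-2))
    * Z ZY2 (-1) * Z ZY3 1 * Z ZC3 (-1) * Z ZT (-1) * Z ZB (-1).

Definition Y31 : torus :=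
  (Z ZY1 1 + q3 1 * Z ZY1 (-2))
      * Z ZY2 (-1) * Z ZY3 1 * Z ZC3 2 * Z ZT (-1) * Z ZB (-1)
  + Z ZY1 1 * (q3 3 * Z ZY2 (-1) + Z ZY2 2)
      * Z ZY3 1 * Z ZC3 2 * Z ZT (-1) * Z ZB 2.

Definition Y32 : torus :=
  q3 1 * Z ZY1 1 * Z ZY2 (-1) * Z ZY3 1 * Z ZC3 2 * Z ZT (-1) * Z ZB (-1)
  + Z ZY1 1 * (q3 4 * Z ZY2 (-1) + q3 1 * Z ZY2 2)
      * Z ZY3 1 * Z ZC3 2 * Z ZT (-1) * Z ZB 2
  + Z ZY1 1 * Z ZY2 2 * Z ZY3 1 * Z ZC3 2 * Z ZT 2 * Z ZB 2.

Definition Cbar : 'M[torus]_3 :=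
  mx3 [:: [:: c1; C12; C13];
          [:: 0;  c2;  C23];
          [:: 0;  0;   c3 ]].

Definition Ybar : 'M[torus]_3 :=
  mx3 [:: [:: y3;  0;   0 ];
          [:: Y21; y2;  0 ];
          [:: Y31; Y32; y1]].

End QuantumTorus.

Arguments q18 {R} k%_Z.
Arguments q3 {R} k%_Z.
Arguments E6_q3 {R} k%_Z.
Arguments E6_t {R} i j k%_Z.

Definition central (A : pzRingType) (x : A) : Prop := forall y, x * y = y * x.

(* MathComp has no inverse for matrices over a noncommutative ring. *)
Definition mx_inverse (A : pzRingType) n (M N : 'M[A]_n) : Prop :=
  M *m N = 1%:M /\ N *m M = 1%:M.

(* Main.v *)
(** The relations are identities between finitely many noncommutative Laurent
polynomials. For injectivity, let a = J_1 and b = J_2. Every element of H_{E_6}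
is a combination of the a^i and the a^i w a^j, where i, j are 0, 1 or -1 and w
is (b a^-1)^m b (a b^-1)^n or (b a^-1)^m b^-1 (a b^-1)^n: the cubic relation of
J_3 turns bab and b^-1 a b^-1 into words with fewer letters b^{+-1}, and moves
letters b to the left of letters b^-1 up to such words. To see that the images
of these elements are independent, let the quantum torus act on functions on
Z^2 with values in a field of rational functions. The matrix of J_1 is
triangular with central eigenvalues, so the exponents i, j are separated by
pairing with its eigenvectors; the exponents m, n are then read off the leading
point, for a lexicographic order on Z^2, of each matrix coefficient of w applied
to a delta function. *)

From HB Require Import structures.
Require Import Defs.
From mathcomp Require Import all_boot all_order all_algebra.
From mathcomp Require Import complex reals boolp functions ring zify.
From mathcomp Require Import fraction mpoly.
Set Implicit Arguments.
Unset Strict Implicit.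
Unset Printing Implicit Defensive.
Import Order.TTheory GRing.Theory Num.Theory.
Local Open Scope ring_scope.

(** The parameters of H_{E_6} go to central elements of the torus, so the independence to be proved
    is over a Laurent polynomial ring. The commutation form of the quiver has rank two; hence
    functions on Z^2 suffice, and central monomials act on them by scalars. The scalar factors of
    the eight generators are free nonzero elements of a field. Taking them to be suitable Laurent
    monomials in independent variables sends q^{1/3} and the t_i^{(j)} to powers of these variables,
    so the coefficient ring embeds in the field and ordinary linear independence is enough. The two
    families of words need different estimates. After a diagonal conjugation, a b^-1 and a^-1 b
    preserve vectors whose first component dominates, b a^-1 preserves vectors whose third component
    dominates, and b^-1 leads from the first kind to the second. Every leading coefficient that
    matters is a single monomial up to sign, so it stays nonzero for any choice of the scalars, and
    dominance becomes a finite check on exponents. *)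

Lemma addrBK_cancel (V : zmodType) (x y z : V) : x - y + z - x + y = z.
Proof. by rewrite -addrA (addrC (- x)) -(opprB x y) addrAC subrr add0r. Qed.

(** * A spanning set *)

Section TriangleSpan.
Variables (K : comNzRingType) (H : algType K) (a A b B : H).
Variables (a1 a2 b1 b2 m1 m2 m3 m3' : K).
Hypotheses (aA : a * A = 1) (Aa : A * a = 1) (bB : b * B = 1) (Bb : B * b = 1).
Hypotheses (a_sqr : a * a = a1 *: a - a2 *: 1 + A)
  (A_sqr : A * A = a2 *: A - a1 *: 1 + a)
  (b_sqr : b * b = b1 *: b - b2 *: 1 + B)
  (B_sqr : B * B = b2 *: B - b1 *: 1 + b).
Hypotheses (m3K : m3' * m3 = 1)
  (abab : a * b * a * b = m1 *: (a * b) - m2 *: 1 + m3 *: (B * A)).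

Definition tri_pow (i : 'I_3) : H := [:: 1; a; A]`_i.
(** In a normal word all letters b precede all letters B; neighbouring b are joined by A and
    neighbouring B by a. Only the joint of the two blocks is free: it is a if [s] holds and A
    otherwise. The blocks have m + 1 and n letters in the first case, m and n + 1 in the second. *)
Definition tri_word (s : bool) (m n : nat) : H :=
  (b * A) ^+ m * (if s then b else B) * (a * B) ^+ n.

(* [tri_span d] is filtered by the number of letters b and B, which is m + n + 1
   for [tri_word s m n]. *)
Inductive tri_span : nat -> H -> Prop :=
| tri_span0 d : tri_span d 0
| tri_spanD d x y : tri_span d x -> tri_span d y -> tri_span d (x + y)
| tri_span_pow d k i : tri_span d (k *: tri_pow i)
| tri_span_word d k s m n i j : (m + n < d)%N ->
    tri_span d (k *: (tri_pow i * tri_word s m n * tri_pow j)).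

Lemma tri_span_leq d d' x : (d <= d')%N -> tri_span d x -> tri_span d' x.
Proof.
move=> le_d sx; elim: sx le_d => {d x} [d|d x y _ IHx _ IHy|d k i|d k s m n i j lt_d] le_d.
- exact: tri_span0.
- by apply: tri_spanD; [apply: IHx|apply: IHy].
- exact: tri_span_pow.
- by apply: tri_span_word; apply: leq_trans le_d.
Qed.

Lemma tri_spanZ d c x : tri_span d x -> tri_span d (c *: x).
Proof.
elim=> {d x} [d|d x y _ IHx _ IHy|d k i|d k s m n i j lt_d].
- by rewrite scaler0; apply: tri_span0.
- by rewrite scalerDr; apply: tri_spanD.
- by rewrite scalerA; apply: tri_span_pow.
- by rewrite scalerA; apply: tri_span_word.
Qed.

Lemma tri_spanB d x y : tri_span d x -> tri_span d y -> tri_span d (x - y).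
Proof.
move=> sx sy; apply: tri_spanD => //.
by rewrite -scaleN1r; apply: tri_spanZ.
Qed.

Lemma tri_span_comb d (x y z : H) (k l r : K) :
  tri_span d x -> tri_span d y -> tri_span d z ->
  tri_span d (k *: x - l *: y + r *: z).
Proof.
move=> sx sy sz; apply: tri_spanD; last exact: tri_spanZ.
by apply: tri_spanB; apply: tri_spanZ.
Qed.

Lemma tri_span_comb' d (x y z : H) (k l : K) :
  tri_span d x -> tri_span d y -> tri_span d z ->
  tri_span d (k *: x - l *: y + z).
Proof. by rewrite -[X in _ + X]scale1r; apply: tri_span_comb. Qed.

(** Stated for any predicate closed under linear combinations, so that it serves a power standing
    alone as well as one to the left or to the right of a word. *)
Lemma tri_pow_closed (P : H -> Prop) :
  (forall x y, P x -> P y -> P (x + y)) -> (forall k x, P x -> P (k *: x)) ->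
  P 1 -> P a -> P A -> forall i, [/\ P (a * tri_pow i), P (A * tri_pow i),
    P (tri_pow i * a) & P (tri_pow i * A)].
Proof.
move=> PD PZ P1 Pa PA.
have PB x y : P x -> P y -> P (x - y).
  by move=> Px Py; apply: PD => //; rewrite -scaleN1r; apply: PZ.
have Paa : P (a * a) by rewrite a_sqr; apply: PD => //; apply: PB; apply: PZ.
have PAA : P (A * A) by rewrite A_sqr; apply: PD => //; apply: PB; apply: PZ.
by case=> [[|[|[|//]]] i_lt]; rewrite /tri_pow /= ?mulr1 ?mul1r ?aA ?Aa; split.
Qed.

Lemma tri_span_a d x : tri_span d x ->
  [/\ tri_span d (a * x), tri_span d (A * x), tri_span d (x * a) & tri_span d (x * A)].
Proof.
have sp (i : 'I_3) e : tri_span e (tri_pow i).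
  by rewrite -[tri_pow i]scale1r; apply: tri_span_pow.
elim=> {d x} [d|d x y _ [IH1 IH2 IH3 IH4] _ [IH5 IH6 IH7 IH8]|d k i|d k s m n i j lt_d].
- by rewrite !mulr0 !mul0r; split; apply: tri_span0.
- by rewrite !mulrDr !mulrDl; split; apply: tri_spanD.
- rewrite -!scalerAr -!scalerAl.
  have [|||||? ? ? ?] := @tri_pow_closed (tri_span d) _ _ _ _ _ i.
  + exact: tri_spanD.
  + exact: tri_spanZ.
  + exact: (sp 0).
  + exact: (sp 1).
  + exact: (sp 2).
  + by split; apply: tri_spanZ.
- have spw i' j' : tri_span d (tri_pow i' * tri_word s m n * tri_pow j').
    by rewrite -[X in tri_span _ X]scale1r; apply: tri_span_word.
  rewrite -!scalerAr -!scalerAl.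
  move: (tri_word s m n) spw => w spw; rewrite !mulrA -!(mulrA _ (tri_pow j)).
  have [|||||l1 l2 _ _] := @tri_pow_closed
    (fun y => tri_span d (y * w * tri_pow j)) _ _ _ _ _ i.
  + by move=> x y sx sy; rewrite !mulrDl; apply: tri_spanD.
  + by move=> c x sx; rewrite -!scalerAl; apply: tri_spanZ.
  + exact: (spw 0).
  + exact: (spw 1).
  + exact: (spw 2).
  have [|||||_ _ r1 r2] := @tri_pow_closed
    (fun y => tri_span d (tri_pow i * w * y)) _ _ _ _ _ j.
  + by move=> x y sx sy; rewrite mulrDr; apply: tri_spanD.
  + by move=> c x sx; rewrite -scalerAr; apply: tri_spanZ.
  + exact: (spw i 0).
  + exact: (spw i 1).
  + exact: (spw i 2).
  by split; apply: tri_spanZ.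
Qed.

Lemma tri_span_ar d i x : tri_span d x -> tri_span d (x * tri_pow i).
Proof.
move=> sx; have [_ _ sax sAx] := tri_span_a sx.
by case: i => [[|[|[|//]]] i_lt]; rewrite /tri_pow /= ?mulr1.
Qed.

Lemma tri_span_powE d i : tri_span d (tri_pow i).
Proof. by rewrite -[tri_pow i]scale1r; apply: tri_span_pow. Qed.

Lemma tri_span1 d : tri_span d 1.
Proof. exact: (tri_span_powE d 0). Qed.

Lemma tri_span_wordE d s m n : (m + n < d)%N -> tri_span d (tri_word s m n).
Proof.
move=> lt_d; rewrite -[tri_word s m n]scale1r -[tri_word s m n]mul1r.
by rewrite -[1 * _]mulr1; apply: (tri_span_word _ _ 0 0).
Qed.

(** The first letter decides how a new left factor reacts; the rest has one letter fewer, so the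
    induction on the degree applies to it. *)
Lemma tri_word_head s m n : exists2 u : H, tri_span (m + n) u &
  tri_word s m n = (if s || (0 < m)%N then b else B) * u.
Proof.
case: m => [|m]; last first.
  exists (A * tri_word s m n); last by rewrite orbT /tri_word exprS !mulrA.
  by case: (@tri_span_a (m.+1 + n) (tri_word s m n)) => //; apply: tri_span_wordE.
rewrite orbF /tri_word expr0 mul1r; exists ((a * B) ^+ n) => //.
case: n => [|n]; first exact: tri_span1.
rewrite exprS -mulrA; case: (@tri_span_a n.+1 (B * (a * B) ^+ n)) => //.
by have := @tri_span_wordE n.+1 false 0 n (ltnSn n); rewrite /tri_word mul1r.
Qed.

(** All rewriting rules come from [abab]: cancelling a on the left gives the rule for b a b,
    cancelling b on the right gives the one for a b a, and solving the latter for B A B uses that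
    [m3] is invertible. *)
Lemma bab_span : b * a * b = m1 *: b - m2 *: A + m3 *: (A * B * A).
Proof.
have -> : b * a * b = A * (a * b * a * b) by rewrite !mulrA Aa mul1r.
by rewrite abab mulrDr mulrBr -!scalerAr !mulrA Aa mul1r mulr1.
Qed.

Lemma aba_span : a * b * a = m1 *: a - m2 *: B + m3 *: (B * A * B).
Proof.
have -> : a * b * a = (a * b * a * b) * B by rewrite -!mulrA bB mulr1.
by rewrite abab mulrDl mulrBl -!scalerAl -(mulrA a) bB mulr1 mul1r.
Qed.

Lemma BAB_span : B * A * B = m3' *: (a * b * a - m1 *: a + m2 *: B).
Proof.
rewrite aba_span addrBK_cancel.
by rewrite scalerA m3K scale1r.
Qed.

(** A new factor extends a normal word, cancels its first letter, or forms with it a pattern that a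
    relation shortens. The exception is B meeting b across a or A: the exchange keeps the number of
    letters but moves b to the left of B. *)
Lemma tri_span_b d x : tri_span d x ->
  tri_span d.+1 (b * x) /\ tri_span d.+1 (B * x).
Proof.
elim: d x => [|d IHd] x sx.
  move: sx; move e0: 0%N => d sx; elim: sx e0 => {d x}.
  - by move=> *; rewrite !mulr0; split; apply: tri_span0.
  - by move=> d x y _ IHx _ IHy d0; rewrite !mulrDr;
      have [? ?] := IHx d0; have [? ?] := IHy d0; split; apply: tri_spanD.
  - move=> d k i <-; rewrite -!scalerAr; split; apply/tri_spanZ/tri_span_ar.
      by have := @tri_span_wordE 1 true 0 0 isT; rewrite /tri_word !expr0 mul1r mulr1.
    by have := @tri_span_wordE 1 false 0 0 isT; rewrite /tri_word !expr0 mul1r mulr1.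
  - by move=> d k s m n i j + e0; rewrite -e0 ltn0.
have spb u : tri_span d u -> tri_span d.+1 (b * u) by case/IHd.
have spB u : tri_span d u -> tri_span d.+1 (B * u) by case/IHd.
have spa e u : tri_span e u -> tri_span e (a * u) by case/tri_span_a.
have spA e u : tri_span e u -> tri_span e (A * u) by case/tri_span_a.
have up e u : tri_span e u -> tri_span e.+1 u by apply: tri_span_leq.
have sbb u : tri_span d u -> tri_span d.+1 (b * (b * u)).
  move=> su; rewrite mulrA b_sqr !mulrDl mulNr -!scalerAl mul1r.
  apply: tri_spanD; last exact: spB.
  by apply: tri_spanB; apply: tri_spanZ; [apply: spb|apply: up].
have sBB u : tri_span d u -> tri_span d.+1 (B * (B * u)).
  move=> su; rewrite mulrA B_sqr !mulrDl mulNr -!scalerAl mul1r.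
  apply: tri_spanD; last exact: spb.
  by apply: tri_spanB; apply: tri_spanZ; [apply: spB|apply: up].
have sBAB u : tri_span d u -> tri_span d.+1 (B * (A * (B * u))).
  move=> su; rewrite !mulrA BAB_span -scalerAl !(mulrDl, mulNr) -!scalerAl -!mulrA.
  apply: tri_spanZ; apply: tri_spanD; last exact/tri_spanZ/spB.
  by apply: tri_spanB; [apply/spa/spb/spa|apply/tri_spanZ/up/spa].
have sbab u : tri_span d u -> tri_span d.+1 (b * (a * (b * u))).
  move=> su; rewrite !mulrA bab_span !(mulrDl, mulNr) -!scalerAl -!mulrA.
  by apply: tri_span_comb; [apply: spb|apply/up/spA|apply/spA/spB/spA].
(* the bound for B in degree d + 1 uses the one for b in the same degree *)
have Sb u : tri_span d.+1 u -> tri_span d.+2 (b * u).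
  clear x sx; move e: d.+1 => e' sx; elim: sx e => {e' u}.
  - by move=> *; rewrite mulr0; apply: tri_span0.
  - by move=> ? x y _ IHx _ IHy e; rewrite mulrDr; apply: tri_spanD; [apply: IHx|apply: IHy].
  - move=> ? k i <-; rewrite -scalerAr; apply/tri_spanZ/tri_span_ar.
    by have := @tri_span_wordE d.+2 true 0 0 isT; rewrite /tri_word !expr0 mul1r mulr1.
  - move=> e0 k s m n i j lt_d e; subst e0.
    rewrite -scalerAr mulrA; apply/tri_spanZ/tri_span_ar; rewrite mulrA.
    have [u su ew] := tri_word_head s m n.
    have {}su : tri_span d u by apply: tri_span_leq su.
    case: i => [[|[|[|//]]] i_lt]; rewrite /tri_pow /= ?mulr1.
    + rewrite ew; case: ifP => _; first exact/up/sbb.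
      by rewrite mulrA bB mul1r; apply/up/up.
    + case: ifP ew => [_ ->|]; first by rewrite -mulrA; apply/up/sbab.
      case: s m lt_d => -[|m] // lt_d _ _.
      have -> : b * a * tri_word false 0 n = tri_word true 0 n.+1.
        by rewrite /tri_word !mul1r exprS !mulrA.
      exact: tri_span_wordE.
    + have -> : b * A * tri_word s m n = tri_word s m.+1 n.
        by rewrite /tri_word exprS !mulrA.
      exact: tri_span_wordE.
split; first exact: Sb.
clear IHd; move: sx Sb; move e: d.+1 => e' sx Sb.
elim: sx e Sb => {e' x}.
- by move=> *; rewrite mulr0; apply: tri_span0.
- by move=> ? x y _ IHx _ IHy e Sb; rewrite mulrDr; apply: tri_spanD; [apply: IHx|apply: IHy].
- move=> ? k i <- _; rewrite -scalerAr; apply/tri_spanZ/tri_span_ar.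
  by have := @tri_span_wordE d.+2 false 0 0 isT; rewrite /tri_word !expr0 mul1r mulr1.
- move=> e0 k s m n i j lt_d e Sb; subst e0.
  rewrite -scalerAr mulrA; apply/tri_spanZ/tri_span_ar; rewrite mulrA.
  have [u su ew] := tri_word_head s m n.
  have {}su : tri_span d u by apply: tri_span_leq su.
  case: i => [[|[|[|//]]] i_lt]; rewrite /tri_pow /= ?mulr1.
  + rewrite ew; case: ifP => _; last exact/up/sBB.
    by rewrite mulrA Bb mul1r; apply/up/up.
  + case: ifP ew => [_ ->|]; last first.
      case: s m lt_d => -[|m] // lt_d _ _.
      have -> : B * a * tri_word false 0 n = B * (a * tri_word false 0 n) by rewrite mulrA.
      have -> : B * (a * tri_word false 0 n) = tri_word false 0 n.+1.
        by rewrite /tri_word !mul1r exprS !mulrA.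
      exact: tri_span_wordE.
    (* Replacing B by B * B * b creates the pattern b a b; expanding B * B afterwards brings a
       letter b to the front. *)
    have -> : B * a * (b * u) = B * B * (b * a * b) * u.
      by rewrite !mulrA -(mulrA B B b) Bb mulr1.
    rewrite bab_span !(mulrDr, mulrN) -!scalerAr !(mulrDl, mulNr) -!scalerAl.
    rewrite -(mulrA B B b) Bb mulr1 -!mulrA.
    apply: tri_span_comb; [exact/up/spB|exact/up/sBB/spA|].
    have sv : tri_span d.+1 (A * (B * (A * u))) by apply/spA/spB/spA.
    rewrite mulrA B_sqr !(mulrDl, mulNr) -!scalerAl mul1r.
    apply: tri_span_comb'; [exact/up/sBAB/spA|exact/up|exact: Sb].
  + case: ifP ew => [_ ->|]; last first.
      by case: s m lt_d => -[|m] // _ _ ->; rewrite -mulrA; apply/up/sBAB.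
    (* Trading b for B * B creates the pattern B A B, up to words with fewer letters. *)
    have -> : b * u = B * B * u - b2 *: (B * u) + b1 *: u.
      rewrite B_sqr !(mulrDl, mulNr) -!scalerAl mul1r.
      by rewrite addrBK_cancel.
    rewrite mulrDr mulrBr -!scalerAr -!mulrA.
    apply: tri_spanD; last exact/tri_spanZ/up/spB/spA.
    apply: tri_spanB; last exact/tri_spanZ/up/sBAB.
    rewrite !mulrA BAB_span -!scalerAl !(mulrDl, mulNr) -!scalerAl -!mulrA.
    apply: tri_spanZ; apply: tri_spanD; last exact/tri_spanZ/up/sBB.
    apply: tri_spanB; last exact/tri_spanZ/up/spa/spB.
    exact/spa/Sb/spa/spB.
Qed.

Hypothesis gen_ind : forall P : H -> Prop,
  (forall x y, P x -> P y -> P (x + y)) -> (forall x y, P x -> P y -> P (x * y)) ->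
  (forall k, P (k *: 1)) -> P a -> P b -> P (B * A) -> forall x, P x.

Lemma tri_span_all x : exists d, tri_span d x.
Proof.
(* The generalization to an arbitrary right factor makes the property of x multiplicative: left
   multiplications that preserve the span can be composed. *)
suff H0 : forall e y, tri_span e y -> exists d, tri_span d (x * y).
  by have := H0 0%N 1 (tri_span1 0); rewrite mulr1.
pattern x; move: x; apply: gen_ind.
- move=> x1 x2 IH1 IH2 e y sy; have [[d1 s1] [d2 s2]] := (IH1 e y sy, IH2 e y sy).
  exists (maxn d1 d2); rewrite mulrDl.
  by apply: tri_spanD; [apply: tri_span_leq s1|apply: tri_span_leq s2]; rewrite ?leq_maxl ?leq_maxr.
- move=> x1 x2 IH1 IH2 e y sy; have [d2 s2] := IH2 e y sy.
  by have [d1 s1] := IH1 d2 _ s2; exists d1; rewrite -mulrA.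
- by move=> k e y sy; exists e; rewrite -scalerAl mul1r; apply: tri_spanZ.
- by move=> e y /tri_span_a[sy _ _ _]; exists e.
- by move=> e y /tri_span_b[sy _]; exists e.+1.
- by move=> e y /tri_span_a[_ /tri_span_b[_ sy] _ _]; exists e.+1; rewrite -mulrA.
Qed.

Lemma tri_span_sum x : exists d (k0 : 'I_3 -> K)
    (k : bool * ('I_d * 'I_d) -> 'I_3 -> 'I_3 -> K),
  x = \sum_i k0 i *: tri_pow i + \sum_w \sum_i \sum_j
        k w i j *: (tri_pow i * tri_word w.1 w.2.1 w.2.2 * tri_pow j).
Proof.
have [d sx] := tri_span_all x; exists d.
elim: sx => {d x} [d|d x y _ [k0 [k ->]] _ [l0 [l ->]]|d k i|d k s m n i j lt_d].
- exists (fun=> 0), (fun _ _ _ => 0); rewrite !big1 ?addr0 // => *; rewrite ?scale0r //.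
  by rewrite big1 // => *; rewrite big1 // => *; rewrite scale0r.
- exists (fun i => k0 i + l0 i), (fun w i j => k w i j + l w i j).
  rewrite addrACA -!big_split; congr (_ + _); apply: eq_bigr => w _ /=.
    by rewrite scalerDl.
  rewrite -big_split; apply: eq_bigr => i _ /=; rewrite -big_split.
  by apply: eq_bigr => j _ /=; rewrite scalerDl.
- exists (fun i' => if i' == i then k else 0), (fun _ _ _ => 0).
  rewrite (bigD1 i) //= eqxx !big1 ?addr0 // => [w _|i' /negPf->]; last by rewrite scale0r.
  by rewrite big1 // => *; rewrite big1 // => *; rewrite scale0r.
- have [lt_m lt_n] : (m < d)%N /\ (n < d)%N.
    by split; apply: leq_ltn_trans lt_d; rewrite ?leq_addr ?leq_addl.
  pose w0 := (s, (Ordinal lt_m, Ordinal lt_n)).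
  exists (fun=> 0), (fun w i' j' => if (w == w0) && ((i' == i) && (j' == j)) then k else 0).
  rewrite big1 ?add0r => [|*]; last by rewrite scale0r.
  rewrite (bigD1 w0) //= (bigD1 i) //= (bigD1 j) //= !eqxx /=.
  rewrite !big1 ?addr0 // => [w /negPf->|i' /negPf->|j' /negPf->].
  + by rewrite big1 // => *; rewrite big1 // => *; rewrite scale0r.
  + by rewrite big1 // => *; rewrite scale0r.
  + by rewrite scale0r.
Qed.
End TriangleSpan.

(** * Laurent polynomials inside rational functions *)

Section LaurentInjective.
Variables (K : fieldType) (n : nat) (I : Type) (e : 'I_n -> I).
Hypothesis e_surj : forall i, exists k, e k = i.
Variables (N : 'I_n -> nat) (theta : {rmorphism laurent K I -> {fraction {mpoly K[n]}}}).
Hypotheses (N_gt0 : forall k, (0 < N k)%N)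
  (thetaC : forall a : K, theta a%:A = tofrac a%:MP)
  (thetaX : forall k, theta (pgen _ (Pos (e k))) = tofrac ('X_k ^+ N k)).

Definition laurent_of_mpoly : {mpoly K[n]} -> laurent K I :=
  mmap (in_alg (laurent K I)) (fun k => pgen _ (Pos (e k))).
HB.instance Definition _ := GRing.RMorphism.on laurent_of_mpoly.

Let powN (m : 'X_{1..n}) : 'X_{1..n} := [multinom (N k * m k)%N | k < n].

Lemma powN_inj : injective powN.
Proof.
move=> m1 m2 /mnmP eq_m; apply/mnmP => k; have := eq_m k; rewrite !mnmE.
by move/eqP; rewrite eqn_pmul2l // => /eqP.
Qed.

Lemma laurent_of_mpolyE p :
  theta (laurent_of_mpoly p) = tofrac (\sum_(m <- msupp p) p@_m *: 'X_[powN m]).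
Proof.
rewrite /laurent_of_mpoly /mmap !rmorph_sum; apply: eq_bigr => m _ /=.
rewrite rmorphM /= thetaC -mul_mpolyC rmorphM /=; congr (_ * _).
rewrite /mmap1 (mpolyXE_id _ (powN m)) !rmorph_prod; apply: eq_bigr => k _ /=.
by rewrite rmorphXn /= thetaX -rmorphXn /= -exprM mnmE.
Qed.

(** Multiplying the exponents by positive factors keeps distinct monomials distinct, so each
    coefficient of p can still be read off. *)
Lemma laurent_of_mpoly_eq0 p : theta (laurent_of_mpoly p) = 0 -> p = 0.
Proof.
rewrite laurent_of_mpolyE => /eqP; rewrite tofrac_eq0 => /eqP p0.
apply/mpolyP => m; rewrite mcoeff0; have [//|pm] := eqVneq p@_m 0.
have := congr1 (fun q => q@_(powN m)) p0; rewrite mcoeff0 linear_sum /= => <-.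
rewrite (bigD1_seq m) ?msupp_uniq ?mcoeff_msupp //=.
rewrite mcoeffZ mcoeffX eqxx mulr1 big1 ?addr0 // => m' /negPf ne_m.
by rewrite mcoeffZ mcoeffX (inj_eq powN_inj) ne_m mulr0.
Qed.

(** Reduces injectivity to polynomials; the witness [u'] makes the denominator a unit, so that x is
    recovered from its multiple. *)
Lemma laurent_clear_denom (x : laurent K I) : exists u u' p,
  laurent_of_mpoly u * u' = 1 /\ laurent_of_mpoly u * x = laurent_of_mpoly p.
Proof.
have gX k : laurent_of_mpoly 'X_k = pgen _ (Pos (e k)).
  by rewrite /laurent_of_mpoly mmapX mmap1U.
elim/presented_ind: x; elim=> [[i|i]|a|s [u [u' [p [uu' up]]]] t [v [v' [q [vv' vq]]]]
  |s [u [u' [p [uu' up]]]] t [v [v' [q [vv' vq]]]]].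
- by have [k <-] := e_surj i; exists 1, 1, 'X_k; rewrite gX rmorph1 !mul1r.
- have [k <-] := e_surj i; exists 'X_k, (pgen _ (Neg (e k))), 1.
  rewrite gX rmorph1 -[pclass _ _]/(pgen _ _) -pclassM.
  by split; apply/pclassP/cong_rel/laurent_inv.
- by exists 1, 1, a%:MP; rewrite rmorph1 !mul1r pclassCst /laurent_of_mpoly mmapC.
- exists (u * v), (u' * v'), (p * v + q * u); rewrite !rmorphD !rmorphM /= mulrACA uu' vv' mulr1.
  split=> //; rewrite pclassD mulrDr -up -vq; congr (_ + _); last first.
    by rewrite (mulrC (laurent_of_mpoly u)) mulrAC.
  by rewrite mulrAC.
- exists (u * v), (u' * v'), (p * q); rewrite !rmorphM /= mulrACA uu' vv' mulr1.
  by split=> //; rewrite pclassM mulrACA up vq.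
Qed.

Lemma laurent_inj : injective theta.
Proof.
apply: raddf_inj => x x0; have [u [u' [p [uu' up]]]] := laurent_clear_denom x.
have p0 : p = 0 by apply: laurent_of_mpoly_eq0; rewrite -up rmorphM /= x0 mulr0.
by rewrite -[x]mul1r -uu' mulrAC up p0 rmorph0 mul0r.
Qed.
End LaurentInjective.

(** * The ring of linear endomorphisms *)

Section Endo.
Variables (K : comNzRingType) (V : lmodType K).

Record endo := Endo { endo_fun :> V -> V; endo_linear : linear endo_fun }.

HB.instance Definition _ := gen_eqMixin endo.
HB.instance Definition _ := gen_choiceMixin endo.

Lemma endoP (f g : endo) : f =1 g -> f = g.
Proof.
case: f g => [f fD] [g gD] /= /funext fg; rewrite fg in fD *.
by congr Endo; apply: Prop_irrelevance.
Qed.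

Lemma endoD (f : endo) : {morph f : x y / x + y}.
Proof. by move=> x y; rewrite -[x]scale1r endo_linear !scale1r. Qed.
Lemma endo_0 (f : endo) : f 0 = 0.
Proof. by apply: (@addrI _ (f 0)); rewrite -endoD !addr0. Qed.
Lemma endoZ (f : endo) c : {morph f : x / c *: x}.
Proof. by move=> x; rewrite -[c *: x]addr0 endo_linear endo_0 addr0. Qed.

Fact endo_add_linear (f g : endo) : linear (fun x : V => f x + g x).
Proof. by move=> c x y; rewrite !endo_linear scalerDr addrACA. Qed.
Fact endo_opp_linear (f : endo) : linear (fun x : V => - f x).
Proof. by move=> c x y; rewrite endo_linear opprD scalerN. Qed.
Fact endo_zero_linear : linear (fun _ : V => 0 : V).
Proof. by move=> c x y; rewrite scaler0 addr0. Qed.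
Fact endo_mul_linear (f g : endo) : linear (fun x : V => f (g x)).
Proof. by move=> c x y; rewrite !endo_linear. Qed.
Fact endo_one_linear : linear (fun x : V => x).
Proof. by []. Qed.

Definition endo_add f g := Endo (endo_add_linear f g).
Definition endo_opp f := Endo (endo_opp_linear f).
Definition endo_zero := Endo endo_zero_linear.
Definition endo_mul f g := Endo (endo_mul_linear f g).
Definition endo_one := Endo endo_one_linear.

Fact endo_addA : associative endo_add.
Proof. by move=> f g h; apply: endoP => x /=; rewrite addrA. Qed.
Fact endo_addC : commutative endo_add.
Proof. by move=> f g; apply: endoP => x /=; rewrite addrC. Qed.
Fact endo_add0 : left_id endo_zero endo_add.
Proof. by move=> f; apply: endoP => x /=; rewrite add0r. Qed.
Fact endo_addN : left_inverse endo_zero endo_opp endo_add.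
Proof. by move=> f; apply: endoP => x /=; rewrite addNr. Qed.

HB.instance Definition _ :=
  GRing.isZmodule.Build endo endo_addA endo_addC endo_add0 endo_addN.

Fact endo_mulA : associative endo_mul.
Proof. by move=> f g h; apply: endoP. Qed.
Fact endo_mul1 : left_id endo_one endo_mul.
Proof. by move=> f; apply: endoP. Qed.
Fact endo_mulr1 : right_id endo_one endo_mul.
Proof. by move=> f; apply: endoP. Qed.
Fact endo_mulDl : left_distributive endo_mul endo_add.
Proof. by move=> f g h; apply: endoP. Qed.
Fact endo_mulDr : right_distributive endo_mul endo_add.
Proof. by move=> f g h; apply: endoP => x /=; rewrite endoD. Qed.

HB.instance Definition _ := GRing.Zmodule_isPzRing.Build endo
  endo_mulA endo_mul1 endo_mulr1 endo_mulDl endo_mulDr.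

Lemma endo_mulE (f g : endo) x : (f * g) x = f (g x). Proof. by []. Qed.

End Endo.

(** * A representation of the quantum torus on functions on a rank two lattice *)

(* The commutation of two monomials depends only on their total degrees for
   [tdeg] and [sdeg]. *)
Definition tdeg (a : vertex) : int :=
  match a with ZT => 1 | ZB => -1 | _ => 0 end.
Definition sdeg (a : vertex) : int :=
  match a with ZY2 | ZY3 | ZC1 => 1 | ZY1 | ZC2 | ZC3 => -1 | _ => 0 end.

Section LatticeRep.
Variables (R : realType) (F : fieldType) (kappa : {rmorphism R[i] -> F}).
Variables (xi : F) (z : vertex -> F).
Hypotheses (xi_neq0 : xi != 0) (z_neq0 : forall a, z a != 0).

Local Notation lattice_fun := (int * int -> F^o).

Lemma qring_morph : exists h : {rmorphism qring R -> F},
  (forall a, h a%:A = kappa a) /\ (forall k, h (q18 k) = xi ^ k).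
Proof.
pose g (i : invgen unit) := match i with Pos _ => xi | Neg _ => xi^-1 end.
have [|s t|h [hX hC]] := @lift_rmorphism _ _ (@laurent_rel R[i] unit) F kappa g.
- by move=> a x; rewrite mulrC.
- by case=> [{}s {}t|i] /=; rewrite ?mulfV ?rmorph1 // mulrC.
- exists h; split=> [a|[k|k]]; first exact: hC.
    by rewrite /q18 /lvar /= rmorphXn hX.
  by rewrite /q18 /lvar /= rmorphXn hX exprVn.
Qed.

(** The image of q^{-2/9}, the factor attached to an arrow, when q^{1/18} acts as [xi]. *)
Definition zeta := xi ^- 4.

Lemma zeta_neq0 : zeta != 0. Proof. by rewrite invr_eq0 expf_neq0. Qed.

(* [qop c m s] is c Q^s P^m, where Q P = zeta P Q *)
Definition qop_fun (c : F) (m s : int) (f : lattice_fun) : lattice_fun :=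
  fun x => c * zeta ^ (s * x.1) * f (x.1 - m, x.2 - s).

Fact qop_linear c m s : linear (qop_fun c m s).
Proof.
by move=> k f g; apply/funext => x; rewrite /qop_fun !fctE /= mulrDr mulrCA.
Qed.

Definition qop c m s : endo lattice_fun := Endo (qop_linear c m s).

Lemma qopE c m s f x : qop c m s f x = c * zeta ^ (s * x.1) * f (x.1 - m, x.2 - s).
Proof. by []. Qed.

Lemma qopM c m s c' m' s' :
  qop c m s * qop c' m' s' = qop (c * c' * zeta ^ (- (s' * m))) (m + m') (s + s').
Proof.
apply: endoP => f; apply/funext => x; rewrite endo_mulE !qopE /= !opprD !addrA.
rewrite mulrDl mulrBr addrC !expfzDr ?zeta_neq0 //; ring.
Qed.

Lemma qop1 : qop 1 0 0 = 1.
Proof.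
apply: endoP => f; apply/funext => -[x1 x2].
by rewrite qopE mul0r expr0z !mul1r !subr0.
Qed.

Fact qscalar_zmod : zmod_morphism (fun c => qop c 0 0).
Proof.
move=> c d; apply: endoP => f; apply/funext => x.
by rewrite -[RHS]/(qop c 0 0 f x - qop d 0 0 f x) !qopE !mulrBl.
Qed.

Fact qscalar_monoid : monoid_morphism (fun c => qop c 0 0).
Proof. by split=> [|c d]; rewrite ?qop1 // qopM mul0r oppr0 expr0z mulr1 addr0. Qed.

Definition qscalar c := qop c 0 0.
HB.instance Definition _ := GRing.isZmodMorphism.Build _ _ qscalar qscalar_zmod.
HB.instance Definition _ := GRing.isMonoidMorphism.Build _ _ qscalar qscalar_monoid.

Lemma qscalarE c f x : qscalar c f x = c * f x.
Proof. by case: x => x1 x2; rewrite qopE mul0r expr0z mulr1 !subr0. Qed.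

Definition torus_gen_op (g : invgen vertex) : endo lattice_fun :=
  match g with
  | Pos a => qop (z a) (tdeg a) (sdeg a)
  | Neg a => qop (z a)^-1 (- tdeg a) (- sdeg a)
  end.

Lemma torus_gen_op_exp a k :
  ipow (torus_gen_op (Pos a)) (torus_gen_op (Neg a)) k =
  qop (z a ^ k) (k * tdeg a) (k * sdeg a).
Proof.
have ts : sdeg a * tdeg a = 0 by case: a.
have qopX c m s n : s * m = 0 -> qop c m s ^+ n = qop (c ^+ n) (n%:Z * m) (n%:Z * s).
  move=> sm; elim: n => [|n IHn]; first by rewrite !expr0 !mul0r qop1.
  rewrite exprS IHn qopM -(mulrA n%:Z) sm mulr0 oppr0 expr0z mulr1 -exprS.
  by rewrite intS !mulrDl !mul1r.
case: k => k /=; first by rewrite qopX.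
by rewrite qopX ?mulrNN // exprVn NegzE !mulrN !mulNr.
Qed.

Lemma torus_rep : exists psi : {rmorphism torus R -> endo lattice_fun},
  [/\ forall a k, psi (Z R a k) = qop (z a ^ k) (k * tdeg a) (k * sdeg a),
      forall k, psi (q18 k)%:A = qscalar (xi ^ k) &
      forall a : R[i], psi (a%:A : qring R)%:A = qscalar (kappa a)].
Proof.
have [h [hC hq]] := qring_morph.
have [|s t|psi [psiX psiC]] :=
  @lift_rmorphism _ _ (@torus_rel R) _ (qscalar \o h) torus_gen_op.
- move=> a x; apply: endoP => f.
  have eZ g : (qscalar \o h) a g = h a *: g by apply/funext => y; exact: qscalarE.
  by rewrite !endo_mulE !eZ endoZ.
- have ts a : sdeg a * tdeg a = 0 by case: a.
  case=> {s t} [a|a|a b ab|a b ab ba] /=; rewrite ?hq ?rmorph1.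
  + by rewrite qopM mulNr ts !oppr0 expr0z mulr1 mulfV // !subrr qop1.
  + by rewrite qopM mulrN ts !oppr0 expr0z mulr1 mulVf // !addNr qop1.
  + rewrite /qscalar !qopM mulr0 oppr0 expr0z mulr1 !add0r (addrC (tdeg b)) (addrC (sdeg b)).
    (* The quiver is encoded by a determinant: sdeg b * tdeg a - sdeg a * tdeg b equals 1 for an
       arrow from a to b. *)
    have -> : - (sdeg a * tdeg b) = 1 - sdeg b * tdeg a by case: a b ab => [] [].
    by congr qop; rewrite expfzDr ?zeta_neq0 // expr1z (hq (-4) : h (_ ^+ 4) = zeta); ring.
  + rewrite !qopM (addrC (tdeg b)) (addrC (sdeg b)) (mulrC (z b)); congr (qop (_ * _ ^ _) _ _).
    by case: a b ab ba => [] [].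
- exists psi; split=> [a k|k|a].
  + by rewrite -torus_gen_op_exp /Z; case: k => k /=; rewrite rmorphXn psiX.
  + by rewrite psiC /= hq.
  + by rewrite psiC /= hC.
Qed.

End LatticeRep.

(** * Commutation rules for integer powers *)

Section IntegerPowers.
Variables (A : pzRingType) (x y : A).
Hypotheses (xy : x * y = 1) (yx : y * x = 1).

Lemma ipowS k : ipow x y (k + 1) = ipow x y k * x.
Proof.
case: k => [n|[|n]] /=; first by rewrite addn1 exprSr.
  by rewrite expr1 yx expr0.
by rewrite (exprSr _ n.+1) -mulrA yx mulr1 subn1.
Qed.

Lemma ipowP k : ipow x y (k - 1) = ipow x y k * y.
Proof. by rewrite -[X in _ = ipow _ _ X * _](subrK 1) ipowS -mulrA xy mulr1. Qed.

Lemma int_step_ind (P : int -> Prop) : P 0 ->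
  (forall k, P k -> P (k + 1)) -> (forall k, P k -> P (k - 1)) -> forall k, P k.
Proof.
move=> P0 PS PP; elim/int_rect => // n IHn; first by rewrite intS addrC; apply: PS.
by rewrite intS opprD addrC; apply: PP.
Qed.

Lemma ipowD k l : ipow x y (k + l) = ipow x y k * ipow x y l.
Proof.
elim/int_step_ind: l => [|l IHl|l IHl]; first by rewrite addr0 mulr1.
  by rewrite addrA !ipowS IHl mulrA.
by rewrite addrA !ipowP IHl mulrA.
Qed.

Variables (Q : int -> A) (u : A) (w : int).
Hypotheses (QD : forall k l, Q (k + l) = Q k * Q l) (Q0 : Q 0 = 1)
  (Qcentral : forall k, central (Q k)).
Hypothesis ux : u * x = Q w * (x * u).

Lemma ipow_comm k : u * ipow x y k = Q (w * k) * (ipow x y k * u).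
Proof.
have uy : u * y = Q (- w) * (y * u).
  have {1}-> : y * u = Q w * (u * y).
    transitivity (y * (u * x) * y); first by rewrite -!mulrA xy mulr1.
    by rewrite ux !mulrA -(Qcentral w y) -(mulrA (Q w) y) yx mulr1.
  by rewrite mulrA -QD addNr Q0 mul1r.
elim/int_step_ind: k => [|k IHk|k IHk]; first by rewrite mulr0 Q0 /= expr0 mulr1 !mul1r.
  rewrite ipowS mulrA IHk mulrDr mulr1 QD -!mulrA; congr (_ * _).
  by rewrite ux mulrA -(Qcentral w) !mulrA.
rewrite ipowP mulrA IHk mulrDr mulrN1 QD -!mulrA; congr (_ * _).
by rewrite uy mulrA -(Qcentral (- w)) !mulrA.
Qed.

End IntegerPowers.

(** * Normal forms in the quantum torus *)

Definition vertices := [:: ZY1; ZY2; ZY3; ZC1; ZC2; ZC3; ZT; ZB].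

Definition qcomm (a b : vertex) : int :=
  if arrow a b then 4 else if arrow b a then -4 else 0.

(* [(c, k, e)] encodes c q^{k/18} times the ordered monomial with exponents e,
   listed in the order of [vertices] *)
Definition tterm := ((int * int) * seq int)%type.
Definition tpoly := seq tterm.

Fixpoint exp_add (e f : seq int) : seq int :=
  match e, f with k :: e', l :: f' => k + l :: exp_add e' f' | _, _ => [::] end.
(** The exponent of q^{1/18} produced when Z_v^{l/3} crosses the ordered monomial [e] from right to
    left. *)
Fixpoint exp_comm (vs : seq vertex) (e : seq int) (v : vertex) (l : int) : int :=
  match vs, e with
  | u :: vs', k :: e' => qcomm u v * k * l + exp_comm vs' e' v l
  | _, _ => 0
  end.
Fixpoint exp_twist (vs : seq vertex) (e f : seq int) : int :=
  match vs, e, f with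
  | v :: vs', k :: e', l :: f' => exp_comm vs' e' v l + exp_twist vs' e' f'
  | _, _, _ => 0
  end.

Definition tterm_mul (s t : tterm) : tterm :=
  ((s.1.1 * t.1.1, s.1.2 + t.1.2 + exp_twist vertices s.2 t.2), exp_add s.2 t.2).

Fixpoint tpoly_insert (t : tterm) (p : tpoly) : tpoly :=
  match p with
  | [::] => [:: t]
  | s :: p' => if (s.1.2 == t.1.2) && (s.2 == t.2)
               then ((s.1.1 + t.1.1, s.1.2), s.2) :: p' else s :: tpoly_insert t p'
  end.
Definition tpoly_norm (p : tpoly) : tpoly :=
  [seq t <- foldr tpoly_insert [::] p | t.1.1 != 0].
Definition tpoly_add (p q : tpoly) := tpoly_norm (p ++ q).
Definition tpoly_opp (p : tpoly) : tpoly := [seq ((- t.1.1, t.1.2), t.2) | t <- p].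
Definition tpoly_mul (p q : tpoly) := tpoly_norm [seq tterm_mul s t | s <- p, t <- q].
(** Testing the difference makes the order of the terms in the two lists irrelevant. *)
Definition tpoly_eq (p q : tpoly) := nilp (tpoly_add p (tpoly_opp q)).

Definition tpoly1 : tpoly := [:: ((1, 0), nseq 8 0)].
Definition tpolyZ (v : vertex) (k : int) : tpoly :=
  [:: ((1, 0), [seq (match v, u with
    | ZY1, ZY1 | ZY2, ZY2 | ZY3, ZY3 | ZC1, ZC1 | ZC2, ZC2 | ZC3, ZC3
    | ZT, ZT | ZB, ZB => k | _, _ => 0 end) | u <- vertices])].
Definition tpolyq (k : int) : tpoly := [:: ((1, 6 * k), nseq 8 0)].

Section NormalForm.
Variable R : realType.
Local Arguments Z : simpl never.
Implicit Types (p q : tpoly) (e f : seq int).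

Definition qs (k : int) : torus R := (q18 k)%:A.

Lemma qsD k l : qs (k + l) = qs k * qs l.
Proof.
rewrite /qs -scalerAl mul1r scalerA; congr (_ *: _); rewrite /q18 /lvar; apply: ipowD.
  by rewrite -pclassM; apply/pclassP/cong_rel/laurent_inv.
by rewrite mulrC -pclassM; apply/pclassP/cong_rel/laurent_inv.
Qed.

Lemma qs0 : qs 0 = 1. Proof. exact: scale1r. Qed.

Lemma qs_central k : central (qs k).
Proof. by move=> x; rewrite /qs -scalerAl mul1r -scalerAr mulr1. Qed.

Notation Zv a k := (Z R a k).

Lemma gen_mulV a : pgen (torus_rel (R:=R)) (Pos a) * pgen _ (Neg a) = 1.
Proof. by rewrite -pclassM; apply/pclassP/cong_rel/torus_invr. Qed.

Lemma gen_mulVr a : pgen (torus_rel (R:=R)) (Neg a) * pgen _ (Pos a) = 1.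
Proof. by rewrite -pclassM; apply/pclassP/cong_rel/torus_invl. Qed.

Lemma Z0 a : Zv a 0 = 1. Proof. exact: expr0. Qed.

Lemma ZD a k l : Zv a (k + l) = Zv a k * Zv a l.
Proof. by apply: ipowD; [apply: gen_mulV|apply: gen_mulVr]. Qed.

Lemma qcommN a b : qcomm b a = - qcomm a b.
Proof. by case: a b => [] []. Qed.

Lemma gen_comm a b : pgen (torus_rel (R:=R)) (Pos a) * pgen _ (Pos b) =
  qs (qcomm a b) * (pgen _ (Pos b) * pgen _ (Pos a)).
Proof.
have arr u v : arrow u v -> pgen (torus_rel (R:=R)) (Pos v) * pgen _ (Pos u) =
    qs (- 4) * (pgen _ (Pos u) * pgen _ (Pos v)).
  by move=> uv; rewrite /qs -pclassCst -[pgen _ (Pos u) * _]pclassM -!pclassM;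
    apply/pclassP/cong_rel/torus_arrow.
rewrite /qcomm; case: ifP => [ab|nab].
  by rewrite (arr _ _ ab) mulrA -qsD subrr qs0 mul1r.
case: ifP => [/arr//|nba]; rewrite qs0 mul1r -!pclassM.
by apply/pclassP/cong_rel/torus_noarrow; rewrite ?nab ?nba.
Qed.

Lemma Z_comm a b k l : Zv a k * Zv b l = qs (qcomm a b * k * l) * (Zv b l * Zv a k).
Proof.
pose ic := @ipow_comm (torus R).
apply: (ic _ _ (gen_mulV b) (gen_mulVr b) qs _ _ qsD qs0 qs_central).
have := ic _ _ (gen_mulV a) (gen_mulVr a) qs _ _ qsD qs0 qs_central (gen_comm b a) k.
move=> ->; rewrite mulrA -qsD (qcommN a b).
by rewrite mulNr subrr qs0 mul1r.
Qed.

Fixpoint mono (vs : seq vertex) (e : seq int) : torus R :=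
  match vs, e with v :: vs', k :: e' => Zv v k * mono vs' e' | _, _ => 1 end.

Lemma mono_comm vs e v l :
  mono vs e * Zv v l = qs (exp_comm vs e v l) * (Zv v l * mono vs e).
Proof.
elim: vs e => [|u vs IHvs] [|k e] /=; rewrite ?qs0 ?mulr1 ?mul1r //.
rewrite -mulrA IHvs !mulrA -(qs_central _ (Zv u k)) -(mulrA (qs _) (Zv u k)) Z_comm.
by rewrite !mulrA -qsD addrC.
Qed.

Lemma mono_mul vs e f : size e = size vs -> size f = size vs ->
  mono vs e * mono vs f = qs (exp_twist vs e f) * mono vs (exp_add e f).
Proof.
elim: vs e f => [|v vs IHvs] [|k e] [|l f] //= => [_ _|[se] [sf]].
  by rewrite qs0 !mulr1.
rewrite -mulrA (mulrA (mono vs e)) mono_comm.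
transitivity (qs (exp_comm vs e v l) * (Zv v k * Zv v l) * (mono vs e * mono vs f)).
  by rewrite !mulrA (qs_central _ (Zv v k)).
rewrite IHvs // -ZD qsD -!mulrA; congr (_ * _).
by rewrite !mulrA (qs_central _ (Zv v (k + l))).
Qed.

Definition term_val (t : tterm) : torus R := t.1.1%:~R * (qs t.1.2 * mono vertices t.2).
Definition ev p : torus R := \sum_(t <- p) term_val t.
(** [exp_add] truncates to the shorter list, so the product of terms is faithful only on full lists
    of eight exponents. *)
Definition tpoly_wf p := all (fun t : tterm => size t.2 == 8) p.

Lemma ev_cat p q : ev (p ++ q) = ev p + ev q. Proof. exact: big_cat. Qed.

Lemma ev_insert t p : ev (tpoly_insert t p) = term_val t + ev p.
Proof.
elim: p => [|s p IHp] /=; first by rewrite /ev big_seq1 big_nil addr0.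
case: ifP => [/andP[/eqP e1 /eqP e2]|_]; rewrite /ev !big_cons.
  by rewrite addrA; congr (_ + _); rewrite /term_val /= e1 e2 intrD mulrDl addrC.
by rewrite -/(ev _) IHp addrCA.
Qed.

Lemma ev_norm p : ev (tpoly_norm p) = ev p.
Proof.
rewrite /tpoly_norm {1}/ev big_filter big_mkcond /=.
rewrite (eq_bigr term_val) => [|t _]; last first.
  by case: ifP => // /negPn/eqP t0; rewrite /term_val t0 mul0r.
rewrite -/(ev _); elim: p => [//|t p IHp] /=.
by rewrite ev_insert IHp /ev big_cons.
Qed.

Lemma ev_add p q : ev (tpoly_add p q) = ev p + ev q.
Proof. by rewrite ev_norm ev_cat. Qed.

Lemma ev_opp p : ev (tpoly_opp p) = - ev p.
Proof.
rewrite /ev big_map -sumrN; apply: eq_bigr => t _.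
by rewrite /term_val /= mulrNz mulNr.
Qed.

Lemma ev_mul p q : tpoly_wf p -> tpoly_wf q -> ev (tpoly_mul p q) = ev p * ev q.
Proof.
move=> /allP wp /allP wq; rewrite ev_norm /ev big_allpairs_dep /= mulr_suml.
rewrite big_seq [RHS]big_seq; apply: eq_bigr => s /wp /eqP ws.
rewrite mulr_sumr big_seq [RHS]big_seq; apply: eq_bigr => t /wq /eqP wt.
rewrite -[LHS]/((s.1.1 * t.1.1)%:~R * (qs (s.1.2 + t.1.2 + exp_twist vertices s.2 t.2)
  * mono vertices (exp_add s.2 t.2))) /term_val.
rewrite intrM !qsD -(mulrA (qs _ * qs _)) -mono_mul //.
set x := mono _ s.2; set y := mono _ t.2.
rewrite [RHS]mulrA -[in RHS](mulrA s.1.1%:~R) (commr_int (qs _ * x)) -!mulrA.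
do 2!congr (_ * _).
by rewrite !mulrA -(mulrA (qs _) x) -(qs_central _ x) !mulrA.
Qed.

Lemma ev_eq p q : tpoly_eq p q -> ev p = ev q.
Proof.
move=> /nilP pq; apply/eqP; rewrite -subr_eq0 -ev_opp -ev_add pq.
by rewrite /ev big_nil.
Qed.

Lemma ev1 : ev tpoly1 = 1.
Proof. by rewrite /ev big_seq1 /term_val /= qs0 !Z0 !mulr1. Qed.

Lemma ev_Z v k : ev (tpolyZ v k) = Zv v k.
Proof.
by rewrite /ev big_seq1 /term_val /= qs0; case: v; rewrite /= !Z0 ?mulr1 ?mul1r.
Qed.

Lemma ev_q k : ev (tpolyq k) = q3 k.
Proof. by rewrite /ev big_seq1 /term_val /= !Z0 !mulr1 mul1r. Qed.

End NormalForm.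

Lemma wf_norm p : tpoly_wf p -> tpoly_wf (tpoly_norm p).
Proof.
have wfi t q : size t.2 == 8 -> tpoly_wf q -> tpoly_wf (tpoly_insert t q).
  elim: q => [|s q IHq] /=; first by move->.
  by move=> st /andP[ss wq]; case: ifP => _ /=; rewrite ss // IHq.
move=> wp; have /allP w : tpoly_wf (foldr tpoly_insert [::] p).
  by elim: p wp => //= t p IHp /andP[st /IHp]; apply: wfi.
by rewrite /tpoly_wf all_filter; apply/allP => t /w st; apply/implyP.
Qed.

Lemma wf_opp p : tpoly_wf p -> tpoly_wf (tpoly_opp p).
Proof. by rewrite /tpoly_wf /tpoly_opp all_map. Qed.

Lemma wf_add p q : tpoly_wf p -> tpoly_wf q -> tpoly_wf (tpoly_add p q).
Proof. by move=> wp wq; apply: wf_norm; rewrite /tpoly_wf all_cat; apply/andP. Qed.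

Lemma wf_mul p q : tpoly_wf p -> tpoly_wf q -> tpoly_wf (tpoly_mul p q).
Proof.
have sza e f : size (exp_add e f) = minn (size e) (size f).
  by elim: e f => [|k e IHe] [|l f] //=; rewrite IHe minnSS.
move=> /allP wp /allP wq; apply: wf_norm; apply/allP => _ /allpairsP[[s t] /= [ps qt ->]].
by rewrite sza (eqP (wp _ ps)) (eqP (wq _ qt)).
Qed.

(** * Reification of expressions in the torus *)

Inductive texp : Type :=
| TZ of vertex & int | Tq of int | TAdd of texp & texp | TMul of texp & texp | TOpp of texp.

Fixpoint teval (R : realType) (e : texp) : torus R :=
  match e with
  | TZ v k => Z R v k
  | Tq k => q3 k
  | TAdd e f => teval R e + teval R f
  | TMul e f => teval R e * teval R f
  | TOpp e => - teval R e
  end.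

Fixpoint tnorm (e : texp) : tpoly :=
  match e with
  | TZ v k => tpolyZ v k
  | Tq k => tpolyq k
  | TAdd e f => tpoly_add (tnorm e) (tnorm f)
  | TMul e f => tpoly_mul (tnorm e) (tnorm f)
  | TOpp e => tpoly_opp (tnorm e)
  end.

Lemma wf_tnorm e : tpoly_wf (tnorm e).
Proof.
elim: e => //= [e we f tpoly_wf|e we f tpoly_wf|e we]; first exact: wf_add.
- exact: wf_mul.
- exact: wf_opp.
Qed.

Lemma teval_norm R e : teval R e = ev R (tnorm e).
Proof.
elim: e => /= [v k|k|e -> f ->|e -> f ->|e ->].
- by rewrite ev_Z.
- by rewrite ev_q.
- by rewrite ev_add.
- by rewrite ev_mul ?wf_tnorm.
- by rewrite ev_opp.
Qed.

(** * Matrices over the quantum torus *)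

Definition pmx := seq (seq tpoly).
(** Missing rows and entries default to the zero polynomial; thus the empty list also denotes the
    zero matrix, as in the cubic identities below. *)
Definition pmx_entry (P : pmx) (i j : nat) : tpoly := nth [::] (nth [::] P i) j.
Definition pmx_make (f : nat -> nat -> tpoly) : pmx := mkseq (fun i => mkseq (f i) 3) 3.
Definition pmx_mul (P Q : pmx) : pmx := pmx_make (fun i j =>
  tpoly_add (tpoly_mul (pmx_entry P i 0) (pmx_entry Q 0 j))
    (tpoly_add (tpoly_mul (pmx_entry P i 1) (pmx_entry Q 1 j))
      (tpoly_mul (pmx_entry P i 2) (pmx_entry Q 2 j)))).
Definition pmx_add (P Q : pmx) : pmx :=
  pmx_make (fun i j => tpoly_add (pmx_entry P i j) (pmx_entry Q i j)).
Definition pmx_sub (P Q : pmx) : pmx :=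
  pmx_make (fun i j => tpoly_add (pmx_entry P i j) (tpoly_opp (pmx_entry Q i j))).
Definition pmx_diag (x y z : tpoly) : pmx :=
  [:: [:: x; [::]; [::]]; [:: [::]; y; [::]]; [:: [::]; [::]; z]].
Definition pmx_scal (x : tpoly) : pmx := pmx_diag x x x.
Definition pmx_wf (P : pmx) := all (all tpoly_wf) P.
Definition pmx_eq (P Q : pmx) :=
  all (fun i => all (fun j => tpoly_eq (pmx_entry P i j) (pmx_entry Q i j)) (iota 0 3)) (iota 0 3).

Section PolyMatrix.
Variable R : realType.

Definition evM (P : pmx) : 'M[torus R]_3 := \matrix_(i, j) ev R (pmx_entry P i j).

Lemma pmx_entry_make f (i j : 'I_3) : pmx_entry (pmx_make f) i j = f i j.
Proof. by rewrite /pmx_entry /pmx_make !nth_mkseq. Qed.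

Lemma wf_pmx_entry P i j : pmx_wf P -> tpoly_wf (pmx_entry P i j).
Proof.
move=> /allP wP; have [lt_i|le_i] := ltnP i (size P); last first.
  by rewrite /pmx_entry (nth_default _ le_i) nth_nil.
have /allP wPi := wP _ (mem_nth [::] lt_i).
have [lt_j|le_j] := ltnP j (size (nth [::] P i)); first exact/wPi/mem_nth.
by rewrite /pmx_entry nth_default.
Qed.

Lemma evM_mul P Q : pmx_wf P -> pmx_wf Q -> evM (pmx_mul P Q) = evM P *m evM Q.
Proof.
move=> wP wQ; apply/matrixP => i j; rewrite !mxE pmx_entry_make.
by rewrite !big_ord_recl big_ord0 !mxE addr0 !ev_add !ev_mul // wf_pmx_entry.
Qed.

Lemma evM_sub P Q : evM (pmx_sub P Q) = evM P - evM Q.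
Proof. by apply/matrixP => i j; rewrite !mxE pmx_entry_make ev_add ev_opp. Qed.

Lemma evM_scal x : evM (pmx_scal x) = (ev R x)%:M.
Proof.
apply/matrixP => i j; rewrite !mxE.
by case: i j => [[|[|[|//]]] ?] [[|[|[|//]]] ?] //=; rewrite /ev big_nil.
Qed.

Lemma evM_eq P Q : pmx_eq P Q -> evM P = evM Q.
Proof.
move=> /allP eqP; apply/matrixP => i j; rewrite !mxE; apply: ev_eq.
have /eqP/allP : val i \in iota 0 3 by rewrite mem_iota ltn_ord.
by apply; rewrite mem_iota ltn_ord.
Qed.

End PolyMatrix.

Declare Scope texp_scope.
Delimit Scope texp_scope with texp.
Bind Scope texp_scope with texp.
Local Notation "e + f" := (TAdd e f) : texp_scope.
Local Notation "e * f" := (TMul e f) : texp_scope.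
Local Notation "- e" := (TOpp e) : texp_scope.
Local Notation "e - f" := (TAdd e (TOpp f)) : texp_scope.
Arguments TZ v k%_Z.
Arguments Tq k%_Z.

Definition tc1 : texp :=
  (TZ ZC1 1 * TZ ZC2 2 * TZ ZY3 2 * TZ ZC3 1 * TZ ZT 2 * TZ ZB 2)%texp.
Definition tc2 : texp :=
  (TZ ZC1 1 * TZ ZC2 (-1) * TZ ZY3 (-1) * TZ ZC3 1 * TZ ZT (-1) * TZ ZB (-1))%texp.
Definition tc3 : texp :=
  (TZ ZC1 (-2) * TZ ZC2 (-1) * TZ ZY3 (-1) * TZ ZC3 (-2) * TZ ZT (-1) * TZ ZB
  (-1))%texp.
Definition ty1 : texp :=
  (TZ ZY1 1 * TZ ZY2 2 * TZ ZY3 1 * TZ ZC3 2 * TZ ZT 2 * TZ ZB 2)%texp.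
Definition ty2 : texp :=
  (TZ ZY1 1 * TZ ZY2 (-1) * TZ ZY3 1 * TZ ZC3 (-1) * TZ ZT (-1) * TZ ZB (-1))%texp.
Definition ty3 : texp :=
  (TZ ZY1 (-2) * TZ ZY2 (-1) * TZ ZY3 (-2) * TZ ZC3 (-1) * TZ ZT (-1) * TZ ZB
  (-1))%texp.
Definition tr1 : texp :=
  (TZ ZY1 2 * TZ ZY2 1 * TZ ZC1 2 * TZ ZC2 1 * TZ ZT 2 * TZ ZB 2)%texp.
Definition tr2 : texp :=
  (TZ ZY1 (-1) * TZ ZY2 1 * TZ ZC1 (-1) * TZ ZC2 1 * TZ ZT (-1) * TZ ZB (-1))%texp.
Definition tr3 : texp :=
  (TZ ZY1 (-1) * TZ ZY2 (-2) * TZ ZC1 (-1) * TZ ZC2 (-2) * TZ ZT (-1) * TZ ZB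
  (-1))%texp.
Definition tC12 : texp :=
  (- (Tq 1 * TZ ZC1 1 * TZ ZC2 (-1) * TZ ZY3 (-1) * TZ ZC3 1 * TZ ZT (-1) * TZ
  ZB (-1)) - TZ ZC1 1 * (TZ ZC2 (-1) + Tq (-3) * TZ ZC2 2) * TZ ZY3 (-1) *
  TZ ZC3 1 * TZ ZT 2 * TZ ZB (-1) - TZ ZC1 1 * TZ ZC2 2 * TZ ZY3 (-1) * TZ
  ZC3 1 * TZ ZT 2 * TZ ZB 2)%texp.
Definition tC13 : texp :=
  ((TZ ZC1 1 + Tq 1 * TZ ZC1 (-2)) * TZ ZC2 (-1) * TZ ZY3 (-1) * TZ ZC3 (-2) *
  TZ ZT (-1) * TZ ZB (-1) + TZ ZC1 1 * (Tq 5 * TZ ZC2 (-1) + Tq 2 * TZ ZC2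
  2) * TZ ZY3 (-1) * TZ ZC3 (-2) * TZ ZT 2 * TZ ZB (-1))%texp.
Definition tC23 : texp :=
  (- ((Tq (-1) * TZ ZC1 1 + TZ ZC1 (-2)) * TZ ZC2 (-1) * TZ ZY3 (-1) * TZ ZC3
  (-2) * TZ ZT (-1) * TZ ZB (-1)))%texp.
Definition tY21 : texp :=
  ((Tq (-1) * TZ ZY1 1 + TZ ZY1 (-2)) * TZ ZY2 (-1) * TZ ZY3 1 * TZ ZC3 (-1) *
  TZ ZT (-1) * TZ ZB (-1))%texp.
Definition tY31 : texp :=
  ((TZ ZY1 1 + Tq 1 * TZ ZY1 (-2)) * TZ ZY2 (-1) * TZ ZY3 1 * TZ ZC3 2 * TZ ZT
  (-1) * TZ ZB (-1) + TZ ZY1 1 * (Tq 3 * TZ ZY2 (-1) + TZ ZY2 2) * TZ ZY3 1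
  * TZ ZC3 2 * TZ ZT (-1) * TZ ZB 2)%texp.
Definition tY32 : texp :=
  (Tq 1 * TZ ZY1 1 * TZ ZY2 (-1) * TZ ZY3 1 * TZ ZC3 2 * TZ ZT (-1) * TZ ZB
  (-1) + TZ ZY1 1 * (Tq 4 * TZ ZY2 (-1) + Tq 1 * TZ ZY2 2) * TZ ZY3 1 * TZ
  ZC3 2 * TZ ZT (-1) * TZ ZB 2 + TZ ZY1 1 * TZ ZY2 2 * TZ ZY3 1 * TZ ZC3 2
  * TZ ZT 2 * TZ ZB 2)%texp.

Definition pc1 := Eval vm_compute in tnorm tc1.
Definition pc2 := Eval vm_compute in tnorm tc2.
Definition pc3 := Eval vm_compute in tnorm tc3.
Definition py1 := Eval vm_compute in tnorm ty1.
Definition py2 := Eval vm_compute in tnorm ty2.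
Definition py3 := Eval vm_compute in tnorm ty3.
Definition pr1 := Eval vm_compute in tnorm tr1.
Definition pr2 := Eval vm_compute in tnorm tr2.
Definition pr3 := Eval vm_compute in tnorm tr3.
Definition pC : pmx := Eval vm_compute in
  [:: [:: tnorm tc1; tnorm tC12; tnorm tC13]; [:: [::]; tnorm tc2; tnorm tC23];
      [:: [::]; [::]; tnorm tc3]].
Definition pY : pmx := Eval vm_compute in
  [:: [:: tnorm ty3; [::]; [::]]; [:: tnorm tY21; tnorm ty2; [::]];
      [:: tnorm tY31; tnorm tY32; tnorm ty1]].

(* x^-1 = x^2 - e_1 x + e_2 for a cubic whose roots have product 1 *)
Definition pinv (P : pmx) (x y z : tpoly) : pmx :=
  pmx_add (pmx_sub (pmx_mul P P) (pmx_mul (pmx_scal (tpoly_add x (tpoly_add y z))) P))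
    (pmx_scal (tpoly_add (tpoly_mul x y) (tpoly_add (tpoly_mul x z) (tpoly_mul y z)))).
Definition pCi := Eval vm_compute in pinv pC pc1 pc2 pc3.
Definition pYi := Eval vm_compute in pinv pY py1 py2 py3.
Definition pR := Eval vm_compute in pmx_mul (pmx_scal (tpolyq 2)) (pmx_mul pYi pCi).
Definition pcubic (P : pmx) (x y z : tpoly) : pmx :=
  pmx_mul (pmx_mul (pmx_sub P (pmx_scal x)) (pmx_sub P (pmx_scal y))) (pmx_sub P (pmx_scal z)).
Lemma pC_cubic : pmx_eq (pcubic pC pc1 pc2 pc3) [::]. Proof. by vm_compute. Qed.
Lemma pY_cubic : pmx_eq (pcubic pY py1 py2 py3) [::]. Proof. by vm_compute. Qed.
Lemma pR_cubic : pmx_eq (pcubic pR pr1 pr2 pr3) [::]. Proof. by vm_compute. Qed.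

Definition pcentral (p : tpoly) :=
  all (fun v => tpoly_eq (tpoly_mul p (tpolyZ v 1)) (tpoly_mul (tpolyZ v 1) p)) vertices.

(* Conjugation by the diagonal matrix [pG] aligns the leading degrees of all the
   entries of a matrix. *)
Definition pG : pmx := Eval vm_compute in
  pmx_diag (tnorm (TZ ZC1 3 * TZ ZT 3)) (tpolyZ ZC1 3) tpoly1.
Definition pGi : pmx := Eval vm_compute in
  pmx_diag (tnorm (TZ ZT (-3) * TZ ZC1 (-3))) (tpolyZ ZC1 (-3)) tpoly1.
Definition pconj (P : pmx) := pmx_mul (pmx_mul pGi P) pG.

Definition ga := Eval vm_compute in pconj pC.
Definition gA := Eval vm_compute in pconj pCi.
Definition gb := Eval vm_compute in pconj pY.
Definition gB := Eval vm_compute in pconj pYi.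
Definition pD : pmx := Eval vm_compute in pmx_diag pc1 pc2 pc3.

(* The rows of [pL] are left eigenvectors, and the columns of [pRt] right
   eigenvectors, of the conjugate [ga] of the triangular matrix [pC]. *)
Definition pL : pmx := Eval vm_compute in
  let: (x, y, z) := (tnorm tC12, tnorm tC13, tnorm tC23) in
  let sub p q := tpoly_add p (tpoly_opp q) in
  pconj [:: [:: tpoly_mul (sub pc1 pc2) (sub pc1 pc3); tpoly_mul x (sub pc1 pc3);
               tpoly_add (tpoly_mul y (sub pc1 pc2)) (tpoly_mul x z)];
            [:: [::]; sub pc2 pc3; z]; [:: [::]; [::]; tpoly1]].
Definition pRt : pmx := Eval vm_compute in
  let: (x, y, z) := (tnorm tC12, tnorm tC13, tnorm tC23) in
  let sub p q := tpoly_add p (tpoly_opp q) in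
  pconj [:: [:: tpoly1; tpoly_opp x;
               tpoly_add (tpoly_mul y (sub pc3 pc2)) (tpoly_mul x z)];
            [:: [::]; sub pc1 pc2; tpoly_mul z (sub pc3 pc1)];
            [:: [::]; [::]; tpoly_mul (sub pc3 pc1) (sub pc3 pc2)]].

(* Degrees are in units of Z_a^{1/3}; those of the entries below are multiples of 3. *)
Definition exp_deg (deg : vertex -> int) : seq vertex -> seq int -> int :=
  fix loop vs e := match vs, e with
    | v :: vs', k :: e' => k * deg v + loop vs' e' | _, _ => 0 end.
Definition tcls (e : seq int) : int * int :=
  (exp_deg tdeg vertices e, exp_deg sdeg vertices e).
Definition lexlt (x y : int * int) : bool := (x.2 < y.2)%R || (x.2 == y.2) && (x.1 < y.1)%R.
Definition lexle (x y : int * int) : bool := (x == y) || lexlt x y.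
Definition plexle (p : tpoly) d := all (fun t : tterm => lexle (tcls t.2) d) p.
Definition plexlt (p : tpoly) d := all (fun t : tterm => lexlt (tcls t.2) d) p.
Definition pslt (p : tpoly) (k : int) := all (fun t : tterm => ((tcls t.2).2 < k)%R) p.
(** A single top term with coefficient 1 or -1 cannot cancel and has nonzero image whenever q and
    the generators act with nonzero scalar factors. *)
Definition ptop (p : tpoly) d := plexle p d &&
  if [seq t <- p | tcls t.2 == d] is [:: t] then (t.1.1 == 1) || (t.1.1 == -1) else false.

Definition pall (f : nat -> nat -> bool) := all (fun i => all (f i) (iota 0 3)) (iota 0 3).
(** The condition under which a matrix shifts by d the leading point of every vector dominated by
    its first component, in the sense of [dom1]. *)
Definition pdom1 (P : pmx) d := pall (fun i j => plexle (pmx_entry P i j) d) &&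
  [&& ptop (pmx_entry P 0 0) d, plexlt (pmx_entry P 0 1) d & plexlt (pmx_entry P 0 2) d].

Definition gLb := Eval vm_compute in pmx_mul pL gb.
Definition gAb := Eval vm_compute in pmx_mul gA gb.
Definition gaB := Eval vm_compute in pmx_mul ga gB.
Definition gbA := Eval vm_compute in pmx_mul gb gA.
Lemma gAb_dom : pdom1 gAb (3, 3). Proof. by vm_compute. Qed.
Lemma gaB_dom : pdom1 gaB (3, 6). Proof. by vm_compute. Qed.
Lemma gLb_dom : pall (fun i j => if j == 0 then ptop (pmx_entry gLb i j) (3, 3)
   else plexlt (pmx_entry gLb i j) (3, 3)). Proof. by vm_compute. Qed.
Lemma pRt_dom : pall (fun i j => if i == 0 then ptop (pmx_entry pRt i j) (0, 0)
   else plexle (pmx_entry pRt i j) (0, 0)). Proof. by vm_compute. Qed.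
Lemma pL_dom : pall (fun i j => plexle (pmx_entry pL i j) (0,0) &&
   if j == 2 then ptop (pmx_entry pL i j) (0, 0) else pslt (pmx_entry pL i j) 1). Proof. by vm_compute. Qed.
(** The top degree sits in the first column of the last row, and the other two rows have smaller
    second degree: this is how B turns dominance of the first component into dominance of the
    third. *)
Lemma gB_dom : pall (fun i j => [&& plexle (pmx_entry gB i j) (3, 6),
    (i < 2)%N ==> pslt (pmx_entry gB i j) 6 &
    (i == 2) ==> if j == 0 then ptop (pmx_entry gB i j) (3, 6)
      else plexlt (pmx_entry gB i j) (3, 6)]).
Proof. by vm_compute. Qed.
(** The bound 4 lets the first two columns reach second degree 3, that of the corner; they only meet
    components that are already lower in the second coordinate. *)
Lemma gbA_dom : pall (fun i j => pslt (pmx_entry gbA i j) 4 &&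
   if j == 2 then if i == 2 then ptop (pmx_entry gbA i j) (0,3)
     else pslt (pmx_entry gbA i j) 3 else true).
Proof. by vm_compute. Qed.

(** * Leading terms of matrix coefficients *)

Section LeadingTerms.
Variables (R : realType) (F : fieldType) (xi : F) (z : vertex -> F).
Hypotheses (xi_neq0 : xi != 0) (z_neq0 : forall a, z a != 0).
Local Notation V := (int * int -> F^o).
Variable psi : {rmorphism torus R -> endo V}.
Hypothesis psiZ : forall a k, psi (Z R a k) = qop xi (z a ^ k) (k * tdeg a) (k * sdeg a).
Hypothesis psiq : forall k, psi (q18 k)%:A = qscalar xi (xi ^ k).
Implicit Types (p : tpoly) (f : V) (mu d x : int * int).

Fixpoint zexp (vs : seq vertex) (e : seq int) : F :=
  match vs, e with v :: vs', k :: e' => z v ^ k * zexp vs' e' | _, _ => 1 end.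

Lemma zexp_neq0 vs e : zexp vs e != 0.
Proof.
by elim: vs e => [|v vs IHvs] [|k e] //=; rewrite ?oner_eq0 // mulf_neq0 ?expfz_neq0.
Qed.

(* The vertices of nonzero [tdeg] come last, so that no twist appears. *)
Lemma psi_mono e : psi (mono R vertices e) =
  qop xi (zexp vertices e) (tcls e).1 (tcls e).2.
Proof.
pose ok (vs : seq vertex) := pairwise (fun u v => (tdeg u == 0) || (sdeg v == 0)) vs.
suff mono_op vs : ok vs -> forall e, psi (mono R vs e) =
    qop xi (zexp vs e) (exp_deg tdeg vs e) (exp_deg sdeg vs e) by apply: mono_op.
elim: vs => [|v vs IHvs] /= => [_ {}e|/andP[v_vs /IHvs{}IHvs] [|k {}e]].
- by rewrite rmorph1; case: e => *; rewrite /= qop1.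
- by rewrite rmorph1 qop1.
rewrite rmorphM /= psiZ IHvs qopM //.
suff -> : exp_deg sdeg vs e * (k * tdeg v) = 0 by rewrite oppr0 expr0z mulr1.
have [->|tv] := eqVneq (tdeg v) 0; first by rewrite !mulr0.
suff -> : exp_deg sdeg vs e = 0 by rewrite mul0r.
move: v_vs; rewrite (negPf tv) /=; elim: vs e {IHvs} => [|u vs IHvs] [|l e] //=.
by case/andP=> /eqP-> /IHvs->; rewrite mulr0.
Qed.

Definition tcoef (t : tterm) : F := t.1.1%:~R * (xi ^ t.1.2 * zexp vertices t.2).

Lemma psi_term t : psi (term_val R t) = qop xi (tcoef t) (tcls t.2).1 (tcls t.2).2.
Proof.
rewrite /term_val !rmorphM /= rmorph_int psiq psi_mono.
rewrite -(rmorph_int (qscalar xi)) /qscalar !qopM // !mulr0 !oppr0 !expr0z.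
by rewrite !mulr1 !add0r.
Qed.

Lemma psi_evE p f x : psi (ev R p) f x = \sum_(t <- p)
  tcoef t * zeta xi ^ ((tcls t.2).2 * x.1) * f (x - tcls t.2).
Proof.
rewrite /ev; elim: p => [|t p IHp]; first by rewrite !big_nil rmorph0.
by rewrite !big_cons rmorphD /= -IHp psi_term.
Qed.

Definition vanish (S : int * int -> bool) f := forall x, S x -> f x = 0.

Lemma vanish_psi (S S' : int * int -> bool) p f :
  (forall t x, t \in p -> S' x -> S (x - tcls t.2)) ->
  vanish S f -> vanish S' (psi (ev R p) f).
Proof.
move=> SS' f0 x S'x; rewrite psi_evE big_seq big1 // => t t_p.
by rewrite f0 ?mulr0 //; apply: SS'.
Qed.

Lemma plexle_psi p d mu f : plexle p d -> vanish (lexlt mu) f ->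
  vanish (lexlt (mu + d)) (psi (ev R p) f).
Proof.
move=> /allP pd; apply: vanish_psi => t x /pd {pd}; move: (tcls t.2) x mu d.
move=> [c1 c2] [x1 x2] [m1 m2] [d1 d2]; rewrite /lexle /lexlt xpair_eqE /=; lia.
Qed.

Lemma plexlt_psi p d mu f : plexlt p d -> vanish (lexlt mu) f ->
  vanish (lexle (mu + d)) (psi (ev R p) f).
Proof.
move=> /allP pd; apply: vanish_psi => t x /pd {pd}; move: (tcls t.2) x mu d.
move=> [c1 c2] [x1 x2] [m1 m2] [d1 d2]; rewrite /lexle /lexlt xpair_eqE /=; lia.
Qed.

(** The second coordinates are integers: shifts of at most k - 1 applied to a support bounded by l -
    1 reach at most k + l - 2. *)
Lemma pslt_psi p k l f : pslt p k -> vanish (fun x => (l <= x.2)%R) f ->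
  vanish (fun x => (k + l - 1 <= x.2)%R) (psi (ev R p) f).
Proof.
move=> /allP pd; apply: vanish_psi => t x /pd {pd}; move: (tcls t.2) x.
move=> [c1 c2] [x1 x2] /=; lia.
Qed.

(** At mu + d a term of smaller degree evaluates f beyond mu, where f vanishes, so only the top term
    contributes. *)
Lemma ptop_psi p d mu f : ptop p d -> vanish (lexlt mu) f -> f mu != 0 ->
  psi (ev R p) f (mu + d) != 0.
Proof.
move=> /andP[/allP pd]; case ef: [seq t <- p | tcls t.2 == d] => [|t [|//]] //= t1 f0 fmu.
rewrite psi_evE (bigID (fun t => tcls t.2 == d)).
rewrite [X in _ + X != 0]big1_seq => [|s /andP[ne_sd /pd sd]]; last first.
  rewrite f0 ?mulr0 //; move: (tcls s.2) sd ne_sd => c.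
  case: c mu d {f0 fmu pd ef} => [c1 c2] [m1 m2] [d1 d2].
  rewrite /lexle /lexlt !xpair_eqE /=; lia.
rewrite addr0 -big_filter ef big_seq1.
have : t \in [seq t <- p | tcls t.2 == d] by rewrite ef mem_head.
rewrite mem_filter => /andP[/eqP -> _]; rewrite addrK.
rewrite !mulf_neq0 ?expfz_neq0 ?zexp_neq0 ?zeta_neq0 //.
by case/orP: t1 => /eqP->; rewrite ?mulrN1z ?oppr_eq0 oner_eq0.
Qed.

Definition act (M : 'M[torus R]_3) (f : 'I_3 -> V) : 'I_3 -> V :=
  fun i => \sum_j psi (M i j) (f j).

Lemma actM (M N : 'M[torus R]_3) (g : 'I_3 -> V) : act (M *m N) g = act M (act N g).
Proof.
apply/funext => i; rewrite /act.
have sumE (h : 'I_3 -> endo V) v : (\sum_k h k) v = \sum_k h k v.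
  by elim/big_rec2: _ => // k u w _ <-.
have endo_sum (h : endo V) (w : 'I_3 -> V) : h (\sum_k w k) = \sum_k h (w k).
  by elim/big_rec2: _ => [|k u v _ <-]; rewrite ?endo_0 ?endoD.
under [RHS]eq_bigr do rewrite endo_sum.
rewrite exchange_big; apply: eq_bigr => j _; rewrite mxE rmorph_sum sumE.
by apply: eq_bigr => k _; rewrite rmorphM.
Qed.

Definition dom1 (f : 'I_3 -> V) mu := (forall i, vanish (lexlt mu) (f i)) /\ f 0 mu != 0.
(** The first two components are required to drop in the second coordinate, and not merely in the
    order, because [pslt] leaves the first coordinates of the matrix entries unbounded. *)
Definition dom3 (f : 'I_3 -> V) mu :=
  [/\ forall i : 'I_3, (i < 2)%N -> vanish (fun x => (mu.2 <= x.2)%R) (f i),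
      vanish (lexlt mu) (f 2) & f 2 mu != 0].

Lemma act_evM P (f : 'I_3 -> V) i : act (evM R P) f i =
  psi (ev R (pmx_entry P i 0)) (f 0) + psi (ev R (pmx_entry P i 1)) (f 1) +
  psi (ev R (pmx_entry P i 2)) (f 2).
Proof.
rewrite /act !big_ord_recl big_ord0 addr0 !mxE addrA.
by congr (_ + psi (ev R (pmx_entry P i 1)) (f _) + psi (ev R (pmx_entry P i 2)) (f _));
  apply: val_inj.
Qed.

Lemma vanishD (S : int * int -> bool) f g : vanish S f -> vanish S g -> vanish S (f + g).
Proof. by move=> f0 g0 x Sx; rewrite -[LHS]/(f x + g x) f0 ?g0 ?addr0. Qed.

Lemma vanish_act (S : int * int -> bool) P (f : 'I_3 -> V) (i : 'I_3) :
  (forall j : 'I_3, vanish S (psi (ev R (pmx_entry P i j)) (f j))) ->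
  vanish S (act (evM R P) f i).
Proof.
move=> H; rewrite act_evM; apply: vanishD; last exact: (H 2).
by apply: vanishD; [apply: (H 0)|apply: (H 1)].
Qed.

Lemma pallP (h : nat -> nat -> bool) : pall h -> forall i j : 'I_3, h i j.
Proof.
move=> /allP H i j; have /H/allP : val i \in iota 0 3 by rewrite mem_iota ltn_ord.
by apply; rewrite mem_iota ltn_ord.
Qed.

Lemma vanishS (S S' : int * int -> bool) f : (forall x, S' x -> S x) -> vanish S f -> vanish S' f.
Proof. by move=> SS' f0 x /SS'; apply: f0. Qed.

Lemma lexlt_above mu f : vanish (lexlt mu) f -> vanish (fun x => (mu.2 + 1 <= x.2)%R) f.
Proof. by apply: vanishS => -[x1 x2]; case: mu => m1 m2; rewrite /lexlt /=; lia. Qed.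

Definition lead f mu := vanish (lexlt mu) f /\ f mu != 0.

Lemma lead_dom1 P (i : 'I_3) d (f : 'I_3 -> V) mu : dom1 f mu ->
  ptop (pmx_entry P i 0) d -> plexlt (pmx_entry P i 1) d -> plexlt (pmx_entry P i 2) d ->
  lead (act (evM R P) f i) (mu + d).
Proof.
move=> [f_le f_mu] top0 lt1 lt2.
have v0 := plexle_psi (proj1 (andP top0)) (f_le 0).
have v1 := plexlt_psi lt1 (f_le 1); have v2 := plexlt_psi lt2 (f_le 2).
have lexW x y : lexlt x y -> lexle x y by rewrite /lexle orbC => ->.
have lexR x : lexle x x by rewrite /lexle eqxx.
rewrite act_evM; split.
  by do 2?[apply: vanishD => //]; apply: vanishS (lexW _) _.
rewrite -[X in X != 0]/(psi (ev R (pmx_entry P i 0)) (f 0) (mu + d) +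
  psi (ev R (pmx_entry P i 1)) (f 1) (mu + d) + psi (ev R (pmx_entry P i 2)) (f 2) (mu + d)).
rewrite v1 // v2 // !addr0; apply: ptop_psi => //; exact: f_le.
Qed.

Lemma lead_dom3 P (i : 'I_3) d (f : 'I_3 -> V) mu : dom3 f mu ->
  pslt (pmx_entry P i 0) (d.2 + 1) -> pslt (pmx_entry P i 1) (d.2 + 1) ->
  ptop (pmx_entry P i 2) d -> lead (act (evM R P) f i) (mu + d).
Proof.
move=> [f_low f_le f_mu] lt0 lt1 top2.
have v2 := plexle_psi (proj1 (andP top2)) f_le.
have sub x : (mu + d).2 <= x.2 -> (d.2 + 1 + mu.2 - 1 <= x.2)%R.
  by rewrite -[(mu + d).2]/(mu.2 + d.2); lia.
have v0 := vanishS sub (pslt_psi lt0 (f_low 0 isT)).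
have v1 := vanishS sub (pslt_psi lt1 (f_low 1 isT)).
have lexW x : lexlt (mu + d) x -> (mu + d).2 <= x.2.
  by case: (mu + d) x => m1 m2 [x1 x2]; rewrite /lexlt /=; lia.
rewrite act_evM; split.
  by apply: vanishD => //; apply: vanishD; apply: vanishS lexW _.
rewrite -[X in X != 0]/(psi (ev R (pmx_entry P i 0)) (f 0) (mu + d) +
  psi (ev R (pmx_entry P i 1)) (f 1) (mu + d) + psi (ev R (pmx_entry P i 2)) (f 2) (mu + d)).
by rewrite v0 // v1 // !add0r; apply: ptop_psi.
Qed.

(** The missing unit in the second coordinate may be supplied by the component or by the matrix
    entry, whence the two alternatives for each column. *)
Lemma low_act P (i : 'I_3) d (f : 'I_3 -> V) mu :
  (forall j : 'I_3, (j < 2)%N -> vanish (fun x => (mu.2 <= x.2)%R) (f j) /\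
     pslt (pmx_entry P i j) (d.2 + 1) \/ vanish (lexlt mu) (f j) /\ pslt (pmx_entry P i j) d.2) ->
  vanish (lexlt mu) (f 2) -> pslt (pmx_entry P i 2) d.2 ->
  vanish (fun x => ((mu + d).2 <= x.2)%R) (act (evM R P) f i).
Proof.
have sub x : (mu + d).2 <= x.2 -> (d.2 + 1 + mu.2 - 1 <= x.2)%R.
  by rewrite -[(mu + d).2]/(mu.2 + d.2); lia.
have sub' x : (mu + d).2 <= x.2 -> (d.2 + (mu.2 + 1) - 1 <= x.2)%R.
  by rewrite -[(mu + d).2]/(mu.2 + d.2); lia.
move=> H f2 s2; apply: vanish_act => j.
have [lt_j|ge_j] := ltnP j 2.
  have [[fj sj]|[/lexlt_above fj sj]] := H j lt_j.
    exact: vanishS sub (pslt_psi sj fj).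
  exact: vanishS sub' (pslt_psi sj fj).
have -> : j = 2 by apply: val_inj => /=; have := ltn_ord j; lia.
exact: vanishS sub' (pslt_psi s2 (lexlt_above f2)).
Qed.

Lemma dom1_step P d (f : 'I_3 -> V) mu : pdom1 P d -> dom1 f mu -> dom1 (act (evM R P) f) (mu + d).
Proof.
move=> /andP[/pallP le_d /and3P[top0 lt1 lt2]] df; split; last first.
  by case: (lead_dom1 (i := 0) df top0 lt1 lt2).
by move=> i; apply: vanish_act => j; apply: plexle_psi (le_d i j) _; apply: df.1.
Qed.

Lemma lead_step_b (f : 'I_3 -> V) mu i : dom1 f mu ->
  lead (act (evM R gLb) f i) (mu + (3%:Z, 3%:Z)).
Proof.
move=> df; apply: lead_dom1 df _ _ _.
- exact: (pallP gLb_dom i 0).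
- exact: (pallP gLb_dom i 1).
- exact: (pallP gLb_dom i 2).
Qed.

Lemma dom3_step_B (f : 'I_3 -> V) mu : dom1 f mu -> dom3 (act (evM R gB) f) (mu + (3%:Z, 6%:Z)).
Proof.
move=> df; have gB_le i j := and3P (pallP gB_dom i j).
have lead2 : lead (act (evM R gB) f 2) (mu + (3%:Z, 6%:Z)).
  apply: lead_dom1 df _ _ _.
  - by case: (gB_le 2 0).
  - by case: (gB_le 2 1).
  - by case: (gB_le 2 2).
split; [|exact: lead2.1|exact: lead2.2].
move=> i lt_i; apply: low_act.
- by move=> j _; right; split; [apply: df.1|case: (gB_le i j) => _ /implyP->].
- exact: df.1.
- by case: (gB_le i 2) => _ /implyP->.
Qed.

Lemma dom3_step_bA (f : 'I_3 -> V) mu : dom3 f mu -> dom3 (act (evM R gbA) f) (mu + (0%:Z, 3%:Z)).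
Proof.
move=> df; have le i j := andP (pallP gbA_dom i j).
have lead2 : lead (act (evM R gbA) f 2) (mu + (0%:Z, 3%:Z)).
  apply: lead_dom3 df _ _ _.
  - by case: (le 2 0).
  - by case: (le 2 1).
  - by case: (le 2 2).
split; [|exact: lead2.1|exact: lead2.2].
case: df => f_low f_le _ i lt_i; apply: low_act => //.
- by move=> j lt_j; left; split; [apply: f_low|case: (le i j)].
- by case: (le i 2) => _ /=; rewrite ltn_eqF.
Qed.

Lemma lead_step_L (f : 'I_3 -> V) mu i : dom3 f mu -> lead (act (evM R pL) f i) mu.
Proof.
move=> df; have le i' j := andP (pallP pL_dom i' j).
rewrite -[mu]addr0; apply: lead_dom3 df _ _ _.
- by case: (le i 0).
- by case: (le i 1).
- by case: (le i 2).
Qed.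

Definition delta_vec (j : 'I_3) : 'I_3 -> V := fun k x => ((k == j) && (x == 0))%:R.

Lemma act_delta (M : 'M[torus R]_3) (j k : 'I_3) :
  act M (delta_vec j) k = psi (M k j) (delta_vec j j).
Proof.
rewrite /act (bigD1 j) //= big1 ?addr0 // => l /negPf ne_l.
suff -> : delta_vec j l = 0 by rewrite endo_0.
by apply/funext => x; rewrite /delta_vec ne_l.
Qed.

Lemma delta_vec_le j : vanish (lexlt 0) (delta_vec j j).
Proof.
move=> x; rewrite /delta_vec eqxx /=; case: eqP => [->|//].
by rewrite /lexlt /= ltxx.
Qed.

(** Every entry of the first row of [pRt] attains the top degree, so all three right eigenvectors
    start with a dominant first component. *)
Lemma dom1_Rt j : dom1 (act (evM R pRt) (delta_vec j)) 0.
Proof.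
have le (k : 'I_3) := pallP pRt_dom k j.
split=> [k|]; rewrite act_delta mxE.
- rewrite -[0]addr0; apply: plexle_psi (delta_vec_le j).
  by move: (le k); case: ifP => // _ /andP[].
- have := ptop_psi (le 0 : ptop _ (0, 0)) (delta_vec_le j); rewrite addr0; apply.
  by rewrite /delta_vec !eqxx oner_eq0.
Qed.

Lemma dom3_delta : dom3 (delta_vec 2) 0.
Proof.
split; [|exact: delta_vec_le|by rewrite /delta_vec !eqxx oner_eq0].
by move=> i lt_i x _; rewrite /delta_vec -val_eqE /= ltn_eqF.
Qed.

Lemma act_exp (M : 'M[torus R]_3) n (f : 'I_3 -> V) : act (M ^+ n) f = iter n (act M) f.
Proof.
elim: n => [|n IHn]; last by rewrite exprS [LHS]actM IHn.
apply/funext => i; rewrite /act expr0 (bigD1 i) //= mxE eqxx rmorph1 big1 ?addr0 // => j ne_j.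
by rewrite mxE eq_sym (negPf ne_j) rmorph0.
Qed.

Lemma dom1_iter P d n (f : 'I_3 -> V) mu : pdom1 P d -> dom1 f mu ->
  dom1 (act (evM R P ^+ n) f) (mu + d *+ n).
Proof.
move=> Pd df; rewrite act_exp; elim: n => [|n IHn]; first by rewrite addr0.
by rewrite mulrSr addrA /=; apply: dom1_step.
Qed.

Lemma lead_word_b m n i j :
  lead (act (evM R gLb * evM R gAb ^+ m * evM R gaB ^+ n * evM R pRt) (delta_vec j) i)
    ((3%:Z, 6%:Z) *+ n + (3%:Z, 3%:Z) *+ m + (3%:Z, 3%:Z)).
Proof.
rewrite !actM; apply: lead_step_b; apply: dom1_iter gAb_dom _.
by rewrite -[X in dom1 _ X]add0r; apply: dom1_iter gaB_dom _; apply: dom1_Rt.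
Qed.

Lemma lead_word_B m n i j :
  lead (act (evM R pL * evM R gbA ^+ m * evM R gB * evM R gaB ^+ n * evM R pRt) (delta_vec j) i)
    ((3%:Z, 6%:Z) *+ n + (3%:Z, 6%:Z) + (0%:Z, 3%:Z) *+ m).
Proof.
rewrite !actM; apply: lead_step_L; rewrite act_exp.
elim: m => [|m IHm]; last by rewrite mulrSr addrA; apply: dom3_step_bA.
rewrite addr0; apply: dom3_step_B.
by rewrite -[X in dom1 _ X]add0r; apply: dom1_iter gaB_dom _; apply: dom1_Rt.
Qed.

(** Keeps the powers of J_1 away from the points beyond 0, which is where all words have their
    leading points. *)
Lemma vanish_id i j : vanish (lexlt 0) (act (evM R pL * evM R pRt) (delta_vec j) i).
Proof.
rewrite actM; apply: vanish_act => k; rewrite -[0]addr0; apply: plexle_psi.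
  by case/andP: (pallP pL_dom i k).
by case: (dom1_Rt j).
Qed.

End LeadingTerms.

(** * Inverses and spanning in H_{E_6} *)

Section CubicInverse.
Variables (K : comNzRingType) (H : algType K) (x : H) (s1 s2 s3 : K).
Hypothesis s_prod : s1 * s2 * s3 = 1.
Hypothesis cubic : (x - s1%:A) * (x - s2%:A) * (x - s3%:A) = 0.

Definition cubic_e1 := s1 + s2 + s3.
Definition cubic_e2 := s1 * s2 + s1 * s3 + s2 * s3.
Definition cubic_inv : H := x * x - cubic_e1 *: x + cubic_e2%:A.

Lemma cubic_expand : (x - s1%:A) * (x - s2%:A) * (x - s3%:A) =
  x * x * x - cubic_e1 *: (x * x) + cubic_e2 *: x - 1.
Proof.
have step y s : y * (x - s%:A) = y * x - s *: y by rewrite mulrBr -scalerAr mulr1.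
have -> : (x - s1%:A) * (x - s2%:A) = x * x - (s1 + s2) *: x + (s1 * s2)%:A.
  rewrite step mulrBl -scalerAl mul1r scalerBr scalerA scalerDl opprB opprD !addrA.
  by rewrite (mulrC s2) addrAC.
rewrite step mulrDl mulrBl -!scalerAl mul1r scalerDr scalerBr !scalerA (mulrC s3 (s1 * s2)).
rewrite s_prod scale1r /cubic_e1 /cubic_e2 (scalerDl (x * x) (s1 + s2)).
have -> : s1 * s2 + s1 * s3 + s2 * s3 = s1 * s2 + s3 * (s1 + s2) by ring.
rewrite (scalerDl x (s1 * s2)) !opprD opprK !addrA; congr (_ + _ - _).
by rewrite addrAC.
Qed.

Lemma cubic_mulr : x * cubic_inv = 1.
Proof.
apply/eqP; rewrite -subr_eq0 -cubic cubic_expand /cubic_inv mulrDr mulrBr.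
by rewrite -!scalerAr mulr1 mulrA.
Qed.

Lemma cubic_mull : cubic_inv * x = 1.
Proof.
rewrite -cubic_mulr /cubic_inv mulrDr mulrBr !mulrDl mulNr.
by rewrite -!scalerAr -!scalerAl mulr1 mul1r mulrA.
Qed.

Lemma cubic_sqr : x * x = cubic_e1 *: x - cubic_e2 *: 1 + cubic_inv.
Proof.
rewrite /cubic_inv; move: (_ *: x) (_ *: 1) => u v.
by rewrite [RHS]addrC -addrA (addrCA v) subrr addr0 subrK.
Qed.

Lemma cubic_inv_sqr : cubic_inv * cubic_inv = cubic_e2 *: cubic_inv - cubic_e1 *: 1 + x.
Proof.
rewrite {2}/cubic_inv mulrDr mulrBr mulrA cubic_mull mul1r -!scalerAr cubic_mull mulr1.
by rewrite addrC addrCA addrC.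
Qed.
End CubicInverse.

Section HE6Span.
Variable R : realType.
Local Notation K := (E6_base R).
Local Notation H := (HE6 R).
Local Notation J := (@E6_J R).

Definition E6_t3 (i : 'I_3) : K := E6_t i 0 (-1) * E6_t i 1 (-1).

Lemma E6_gen_mulV p : (pgen _ (Pos p) : K) * pgen _ (Neg p) = 1.
Proof. by rewrite -pclassM; apply/pclassP/cong_rel/laurent_inv. Qed.

Lemma E6_t_prod i : E6_t i 0 1 * E6_t i 1 1 * E6_t3 i = 1.
Proof.
rewrite /E6_t3 /E6_t /lvar /= !expr1 mulrACA.
by rewrite !E6_gen_mulV mulr1.
Qed.

Lemma E6_q3V : E6_q3 (-1) * E6_q3 1 = 1 :> K.
Proof. by rewrite /E6_q3 /lvar /= !expr1 mulrC E6_gen_mulV. Qed.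

Lemma E6_cubic i : (J i - (E6_t i 0 1)%:A) * (J i - (E6_t i 1 1)%:A) * (J i - (E6_t3 i)%:A) = 0.
Proof.
have subE (c : K) : J i - c%:A = pclass (@E6_rel R) (Gen i - Cst c)%pres.
  by rewrite pclassD pclassM !pclassCst scaleN1r mulN1r.
by rewrite !subE -[X in X * _]pclassM -pclassM; apply/pclassP/cong_rel/E6_hecke.
Qed.

Lemma E6_J_prod : J 0 * J 1 * J 2 = (E6_q3 (-1))%:A.
Proof. by rewrite -[X in X * _]pclassM -pclassM -pclassCst; apply/pclassP/cong_rel/E6_prod. Qed.

Definition Jinv (i : 'I_3) : H := cubic_inv (J i) (E6_t i 0 1) (E6_t i 1 1) (E6_t3 i).
Lemma J_mulV i : J i * Jinv i = 1.
Proof. exact: cubic_mulr (E6_t_prod i) (E6_cubic i). Qed.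
Lemma J_mulVr i : Jinv i * J i = 1.
Proof. exact: cubic_mull (E6_t_prod i) (E6_cubic i). Qed.

Lemma E6_J2 : J 2 = E6_q3 (-1) *: (Jinv 1 * Jinv 0).
Proof.
have -> : J 2 = Jinv 1 * Jinv 0 * (J 0 * J 1 * J 2).
  by rewrite !mulrA -(mulrA (Jinv 1)) J_mulVr mulr1 J_mulVr mul1r.
by rewrite E6_J_prod -scalerAr mulr1.
Qed.

Lemma E6_J2inv : J 0 * J 1 = E6_q3 (-1) *: Jinv 2.
Proof. by rewrite -[J 0 * J 1]mulr1 -(J_mulV 2) mulrA E6_J_prod -scalerAl mul1r. Qed.

Lemma HE6_ind (P : H -> Prop) :
  (forall x y, P x -> P y -> P (x + y)) -> (forall x y, P x -> P y -> P (x * y)) ->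
  (forall k, P (k *: 1)) -> P (J 0) -> P (J 1) -> P (Jinv 1 * Jinv 0) -> forall x, P x.
Proof.
move=> PD PM PC P0 P1 P2; elim/presented_ind; elim=> [i|k|s IHs t IHt|s IHs t IHt].
- case: i => [[|[|[|//]]] i_lt].
  + by rewrite (_ : Ordinal i_lt = 0) //; apply: val_inj.
  + by rewrite (_ : Ordinal i_lt = 1) //; apply: val_inj.
  + rewrite (_ : Ordinal i_lt = 2); last exact: val_inj.
    by rewrite -[pclass _ _]/(J 2) E6_J2 -[Jinv 1 * _]mul1r scalerAl; apply: PM.
- by rewrite pclassCst.
- by rewrite pclassD; apply: PD.
- by rewrite pclassM; apply: PM.
Qed.

Local Notation pow := (tri_pow (J 0) (Jinv 0)).
Local Notation word := (tri_word (J 0) (Jinv 0) (J 1) (Jinv 1)).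

Lemma HE6_sum x : exists d (k0 : 'I_3 -> K) (k : bool * ('I_d * 'I_d) -> 'I_3 -> 'I_3 -> K),
  x = \sum_i k0 i *: pow i + \sum_w \sum_i \sum_j
        k w i j *: (pow i * word w.1 w.2.1 w.2.2 * pow j).
Proof.
have sqr i := cubic_sqr (J i) (E6_t i 0 1) (E6_t i 1 1) (E6_t3 i).
have inv_sqr i := cubic_inv_sqr (E6_t_prod i) (E6_cubic i).
have qq3 : E6_q3 1 ^+ 3 * E6_q3 (-1) ^+ 3 = 1 :> K by rewrite -exprMn mulrC E6_q3V expr1n.
pose q : K := E6_q3 (-1).
pose e1 : K := cubic_e1 (E6_t 2 0 1) (E6_t 2 1 1) (E6_t3 2).
pose e2 : K := cubic_e2 (E6_t 2 0 1) (E6_t 2 1 1) (E6_t3 2).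
apply: (tri_span_sum (m1 := q * e2) (m2 := q * q * e1)
  (J_mulV 0) (J_mulVr 0) (J_mulV 1) (J_mulVr 1) (sqr 0) (inv_sqr 0)
  (sqr 1) (inv_sqr 1) qq3 _ HE6_ind).
(* J_1 J_2 is a scalar multiple of the inverse of J_3. The square of this inverse is a combination
   of itself, 1 and J_3, and J_3 is in turn a scalar multiple of the inverse of J_1 J_2. *)
rewrite -(mulrA (J 0 * J 1)) E6_J2inv -scalerAl -scalerAr scalerA inv_sqr.
rewrite scalerDr scalerBr !scalerA -/(Jinv 2) E6_J2 scalerA -/q -/e1 -/e2.
by rewrite (mulrAC q e2) !exprS expr0 mulr1 mulrA.
Qed.
End HE6Span.

(** * The matrices and the central elements in normal form *)

Section TorusImages.
Variable R : realType.

Lemma tevalE e p : tnorm e = p -> teval R e = ev R p.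
Proof. by move=> <-; apply: teval_norm. Qed.

Lemma c1E : c1 R = ev R pc1. Proof. by apply: (@tevalE tc1); vm_compute. Qed.
Lemma c2E : c2 R = ev R pc2. Proof. by apply: (@tevalE tc2); vm_compute. Qed.
Lemma c3E : c3 R = ev R pc3. Proof. by apply: (@tevalE tc3); vm_compute. Qed.
Lemma y1E : y1 R = ev R py1. Proof. by apply: (@tevalE ty1); vm_compute. Qed.
Lemma y2E : y2 R = ev R py2. Proof. by apply: (@tevalE ty2); vm_compute. Qed.
Lemma y3E : y3 R = ev R py3. Proof. by apply: (@tevalE ty3); vm_compute. Qed.
Lemma r1E : r1 R = ev R pr1. Proof. by apply: (@tevalE tr1); vm_compute. Qed.
Lemma r2E : r2 R = ev R pr2. Proof. by apply: (@tevalE tr2); vm_compute. Qed.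
Lemma r3E : r3 R = ev R pr3. Proof. by apply: (@tevalE tr3); vm_compute. Qed.

Lemma ev0 : ev R [::] = 0. Proof. exact: big_nil. Qed.

Lemma CbarE : Cbar R = evM R pC.
Proof.
have e12 : C12 R = ev R (pmx_entry pC 0 1) by apply: (@tevalE tC12); vm_compute.
have e13 : C13 R = ev R (pmx_entry pC 0 2) by apply: (@tevalE tC13); vm_compute.
have e23 : C23 R = ev R (pmx_entry pC 1 2) by apply: (@tevalE tC23); vm_compute.
apply/matrixP => i j; rewrite !mxE.
by case: i j => [[|[|[|//]]] ?] [[|[|[|//]]] ?];
  rewrite /= ?c1E ?c2E ?c3E ?e12 ?e13 ?e23 ?ev0.
Qed.

Lemma YbarE : Ybar R = evM R pY.
Proof.
have e21 : Y21 R = ev R (pmx_entry pY 1 0) by apply: (@tevalE tY21); vm_compute.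
have e31 : Y31 R = ev R (pmx_entry pY 2 0) by apply: (@tevalE tY31); vm_compute.
have e32 : Y32 R = ev R (pmx_entry pY 2 1) by apply: (@tevalE tY32); vm_compute.
apply/matrixP => i j; rewrite !mxE.
by case: i j => [[|[|[|//]]] ?] [[|[|[|//]]] ?];
  rewrite /= ?y1E ?y2E ?y3E ?e21 ?e31 ?e32 ?ev0.
Qed.

Lemma torus_central (x : torus R) :
  (forall v, x * Z R v 1 = Z R v 1 * x) -> central x.
Proof.
move=> xZ y; elim/presented_ind: y; elim=> [[v|v]|a|s IHs t IHt|s IHs t IHt].
- exact: xZ.
- rewrite -[pclass _ _]/(pgen _ (Neg v)) -[LHS]mul1r -(gen_mulVr R v).
  rewrite -mulrA (mulrA (pgen _ (Pos v))) -[pgen _ (Pos v)]/(Z R v 1) -xZ.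
  by rewrite -mulrA -[Z R v 1]/(pgen _ (Pos v)) gen_mulV mulr1.
- by rewrite pclassCst -scalerAl mul1r -scalerAr mulr1.
- by rewrite pclassD mulrDl mulrDr IHs IHt.
- by rewrite pclassM mulrA IHs -mulrA IHt mulrA.
Qed.

Lemma ev_central p : tpoly_wf p -> pcentral p -> central (ev R p).
Proof.
move=> wp cp; apply: torus_central => v; rewrite -!ev_Z -!ev_mul //.
apply: ev_eq; move: cp; rewrite /pcentral -[vertices]/[:: _; _; _; _; _; _; _; _].
by move=> /= /and5P[? ? ? ? /and5P[? ? ? ? _]]; case: v.
Qed.

(* [t_val] and [t_inv] are the images of t_i^{(j)} and of its inverse; the latter is the
   product of the two other central elements. *)
Definition t_val (i : 'I_3) (j : 'I_2) : tpoly :=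
  nth [::] (nth [::] [:: [:: pc1; pc2]; [:: py1; py2]; [:: pr1; pr2]] i) j.
Definition t_inv (i : 'I_3) (j : 'I_2) : tpoly :=
  nth [::] (nth [::] [:: [:: tpoly_mul pc2 pc3; tpoly_mul pc1 pc3];
    [:: tpoly_mul py2 py3; tpoly_mul py1 py3];
    [:: tpoly_mul pr2 pr3; tpoly_mul pr1 pr3]] i) j.

Definition E6_image (g : invgen E6_param) : tpoly :=
  match g with
  | Pos Pq3 => tpolyq (-2)
  | Neg Pq3 => tpolyq 2
  | Pos (Pt i j) => t_val i j
  | Neg (Pt i j) => t_inv i j
  end.

(** The last condition says that the images have degree zero, which makes them act by scalars on the
    lattice functions. *)
Lemma E6_image_ok (p : E6_param) :
  [&& tpoly_wf (E6_image (Pos p)), tpoly_wf (E6_image (Neg p)),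
      pcentral (E6_image (Pos p)), pcentral (E6_image (Neg p)),
      tpoly_eq (tpoly_mul (E6_image (Pos p)) (E6_image (Neg p))) tpoly1 &
      all (fun t : tterm => tcls t.2 == (0, 0)) (E6_image (Pos p))].
Proof.
by case: p => [|[[|[|[|//]]] ?] [[|[|//]] ?]]; vm_compute.
Qed.

(** The commutation relation of [laurent] concerns arbitrary terms while the torus is not
    commutative; hence centrality is first extended from the generators to the values of all
    terms. *)
Lemma E6_center_morph : exists eta : {rmorphism E6_base R -> torus R},
  [/\ forall k, central (eta k),
      forall a : R[i], eta a%:A = (a%:A : qring R)%:A &
      forall g, eta (pgen _ g) = ev R (E6_image g)].
Proof.
pose f : {rmorphism R[i] -> torus R} := in_alg (torus R) \o in_alg (qring R).
have fC a : central (f a) by move=> x /=; rewrite -scalerAl mul1r -scalerAr mulr1.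
have imC g : central (ev R (E6_image g)).
  by case: g => p; have /and5P[w1 w2 k1 k2 _] := E6_image_ok p; apply: ev_central.
pose eva := eval f (fun g => ev R (E6_image g)).
have evalC s : central (eva s).
  elim: s => /= [g|a|s IHs t IHt|s IHs t IHt] x; first exact: imC.
  - exact: fC.
  - by rewrite mulrDl mulrDr IHs IHt.
  - by rewrite -mulrA IHt mulrA IHs -mulrA.
have [|s t|eta [etag etaC]] :=
  @lift_rmorphism _ _ (@laurent_rel R[i] E6_param) _ f (fun g => ev R (E6_image g)).
- exact: fC.
- case=> [{}s {}t|p] /=; first exact: evalC.
  have /and5P[w1 w2 _ _ /andP[e1 _]] := E6_image_ok p.
  by rewrite -ev_mul // (ev_eq R e1) ev1 !scale1r.
- exists eta; split=> //; elim/presented_ind; elim=> [g|a|s IHs t IHt|s IHs t IHt] x.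
  + by rewrite etag; apply: imC.
  + by rewrite pclassCst etaC; apply: fC.
  + by rewrite pclassD rmorphD mulrDl mulrDr IHs IHt.
  + by rewrite pclassM rmorphM /= -mulrA IHt mulrA IHs -mulrA.
Qed.
End TorusImages.

(** * A generic point of the parameter space *)

Section GenericPoint.
Variable (F : fieldType) (x : 'I_7 -> F).
Hypothesis x_neq0 : forall k, x k != 0.

(* These values make the images of q^{1/3} and of the t_i^{(j)} powers of
   independent variables. *)
Definition xi_val : F := (x 6)^-1.
Definition z_val (a : vertex) : F :=
  match a with
  | ZY1 => x 3 / x 0
  | ZY2 => x 2 * x 4 * x 5
  | ZY3 => x 0 * x 2 * x 3
  | ZC1 => x 0 * x 1 * x 4
  | ZC2 => x 5 / x 2
  | ZC3 => x 1 / x 4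
  | ZT => (x 1 * x 3 * x 5)^-1
  | ZB => 1
  end.

(** The list stops at index 5, so the seventh variable falls on the default [Pq3]. *)
Definition E6_var (k : 'I_7) : E6_param :=
  nth Pq3 [:: Pt 0 0; Pt 0 1; Pt 1 0; Pt 1 1; Pt 2 0; Pt 2 1] k.
Definition E6_var_exp (k : 'I_7) : nat := if (k < 6)%N then 3%N else 12%N.

Definition t0 : tterm := ((0, 0), [::]).

Lemma z_val_neq0 a : z_val a != 0.
Proof. by case: a; rewrite /= ?oner_eq0 ?invr_eq0 ?mulf_neq0 ?invr_eq0 ?x_neq0 ?mulf_neq0. Qed.

Lemma E6_var_surj p : exists k, E6_var k = p.
Proof.
case: p => [|i j]; first by exists 6.
have ij : (2 * i + j < 7)%N by have := ltn_ord i; have := ltn_ord j; lia.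
exists (Ordinal ij); case: i j ij => [[|[|[|//]]] ?] [[|[|//]] ?] ij;
  by rewrite /E6_var /=; congr Pt; apply: val_inj.
Qed.

Lemma E6_var_coef k :
  tcoef xi_val z_val (head t0 (E6_image (Pos (E6_var k)))) = x k ^+ E6_var_exp k.
Proof.
have nz := x_neq0.
case: k => [[|[|[|[|[|[|[|//]]]]]]] lt_k]; 
  rewrite /E6_var /E6_var_exp /tcoef /= /exprz /z_val /xi_val.
all: try match goal with |- context [x (Ordinal ?h)] =>
  (have -> : Ordinal h = 0 by apply: val_inj) || (have -> : Ordinal h = 1 by apply: val_inj) ||
  (have -> : Ordinal h = 2 by apply: val_inj) || (have -> : Ordinal h = 3 by apply: val_inj) ||
  (have -> : Ordinal h = 4 by apply: val_inj) || (have -> : Ordinal h = 5 by apply: val_inj) ||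
  (have -> : Ordinal h = 6 by apply: val_inj) end.
all: rewrite ?invr1 ?expr1n ?expr0 ?mul1r ?mulr1.
all: try by rewrite exprVn invrK.
all: by field; rewrite ?nz /= ?oner_eq0.
Qed.
End GenericPoint.

Section GenericRep.
Variable R : realType.
Local Notation F := {fraction {mpoly R[i][7]}}.
Local Notation V := (int * int -> F^o).

Definition gen_var (k : 'I_7) : F := tofrac 'X_k.

Lemma gen_var_neq0 k : gen_var k != 0.
Proof.
rewrite tofrac_eq0; apply/eqP => /(congr1 (fun p => p@_U_(k))) /eqP.
by rewrite mcoeffXU eqxx mcoeff0 oner_eq0.
Qed.

Local Notation xi := (xi_val gen_var).
Local Notation z := (z_val gen_var).

Definition gen_cst : {rmorphism R[i] -> F} := @tofrac {mpoly R[i][7]} \o @mpolyC 7 R[i].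

Lemma E6_base_inj : exists theta : {rmorphism E6_base R -> F},
  [/\ injective theta, forall a : R[i], theta a%:A = gen_cst a &
      forall p, theta (pgen _ (Pos p)) = tcoef xi z (head t0 (E6_image (Pos p)))].
Proof.
pose v p := tcoef xi z (head t0 (E6_image (Pos p))).
have vE k : v (E6_var k) = tofrac ('X_k ^+ E6_var_exp k).
  by rewrite /v (E6_var_coef gen_var_neq0) rmorphXn.
have v_neq0 p : v p != 0.
  by have [k <-] := E6_var_surj p; rewrite /v (E6_var_coef gen_var_neq0) expf_neq0 ?gen_var_neq0.
pose g (i : invgen E6_param) := match i with Pos p => v p | Neg p => (v p)^-1 end.
have [|s t|theta [thX thC]] := @lift_rmorphism _ _ (@laurent_rel R[i] E6_param) F gen_cst g.
- by move=> a y; rewrite mulrC.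
- by case=> [{}s {}t|i] /=; rewrite ?mulfV ?rmorph1 // mulrC.
- exists theta; split=> [||p]; [|exact: thC|by rewrite thX].
  apply: (laurent_inj E6_var_surj (N := E6_var_exp)) => [k|a|k].
  + by rewrite /E6_var_exp; case: ifP.
  + exact: thC.
  + by rewrite thX; apply: vE.
Qed.

(** The two actions of the parameters need comparison only on positive generators; uniqueness of
    inverses settles the negative ones. *)
Lemma generic_rep : exists (eta : {rmorphism E6_base R -> torus R})
  (theta : {rmorphism E6_base R -> F}) (psi : {rmorphism torus R -> endo V}),
  [/\ [/\ forall k, central (eta k),
      forall a : R[i], eta a%:A = (a%:A : qring R)%:A &
      forall g, eta (pgen _ g) = ev R (E6_image g)],
    [/\ forall a k, psi (Z R a k) = qop xi (z a ^ k) (k * tdeg a) (k * sdeg a) &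
      forall k, psi (q18 k)%:A = qscalar xi (xi ^ k)],
    injective theta & forall k, psi (eta k) = qscalar xi (theta k)].
Proof.
have xi0 : xi != 0 by rewrite invr_eq0 gen_var_neq0.
have z0 := z_val_neq0 gen_var_neq0.
have [eta [etaZ etaC etaX]] := E6_center_morph R.
have [theta [th_inj thC thX]] := E6_base_inj.
have [psi [psiZ psiq psiC]] := torus_rep gen_cst xi0 z0.
exists eta, theta, psi; split=> //.
have pos p : psi (eta (pgen _ (Pos p))) = qscalar xi (theta (pgen _ (Pos p))).
  rewrite etaX thX; have /and5P[_ _ _ _ /andP[_]] := E6_image_ok p.
  have : size (E6_image (Pos p)) = 1%N.
    by case: p => [|[[|[|[|//]]] ?] [[|[|//]] ?]].
  case: (E6_image (Pos p)) => [//|t [|//]] _ /=; rewrite andbT => /eqP t00.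
  by rewrite /ev big_seq1 (psi_term xi0 psiZ psiq) t00.
elim/presented_ind; elim=> [[p|p]|a|s IHs t IHt|s IHs t IHt].
- exact: pos.
- have pp : (pgen _ (Pos p) : E6_base R) * pgen _ (Neg p) = 1.
    by rewrite -pclassM; apply/pclassP/cong_rel/laurent_inv.
  rewrite -[pclass _ _]/(pgen _ (Neg p)).
  rewrite -[LHS]mulr1 -(rmorph1 (qscalar xi)) -(rmorph1 theta) -pp !rmorphM /=.
  by rewrite mulrA -pos -!rmorphM mulrC pp !rmorph1 mul1r.
- by rewrite pclassCst etaC psiC thC.
- by rewrite pclassD !rmorphD IHs IHt.
- by rewrite pclassM !rmorphM /= IHs IHt.
Qed.
End GenericRep.

(** * Linear independence and injectivity *)

Lemma scalar_mx_central (A : pzRingType) n (a : A) (M : 'M[A]_n) :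
  central a -> a%:M *m M = M *m a%:M.
Proof.
move=> ca; rewrite mul_scalar_mx; apply/matrixP => i j; rewrite !mxE.
rewrite (bigD1 j) //= mxE eqxx big1 ?addr0 // => k /negPf ne_k.
by rewrite mxE ne_k mulr0.
Qed.

(** At the largest leading point among the terms with nonzero coefficient, all the other terms
    vanish. *)
Lemma lead_indep (F : fieldType) (T : finType) (g : T -> int * int -> F^o)
    (mu : T -> int * int) (e : int * int -> F^o) (c : T -> F) :
  injective mu -> (forall t, lead (g t) (mu t)) -> (forall t, lexlt 0 (mu t)) ->
  vanish (lexlt 0) e -> (forall x, e x + \sum_t c t * g t x = 0) -> forall t, c t = 0.
Proof.
move=> mu_inj g_lead mu_gt0 e0 sum0 t0; apply/eqP/negPn/negP => ct0.
(* The coordinates are swapped because [lexlt] compares the second one first. *)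
pose key t : (int *l int)%type := ((mu t).2, (mu t).1).
have [t ct max_t] := @Order.TotalTheory.arg_maxP _ _ T t0 (fun t => c t != 0) key ct0.
have := sum0 (mu t); rewrite e0 // add0r (bigD1 t) //= big1 ?addr0 => [/eqP|s ne_s].
  by rewrite mulf_eq0 (negPf ct) (negPf (g_lead t).2).
have [->|cs] := eqVneq (c s) 0; first by rewrite mul0r.
rewrite (g_lead s).1 ?mulr0 //; have le_st : (key s <= key t)%O := max_t s cs.
move: le_st; rewrite /key lexi_pair.
have : mu s != mu t by rewrite (inj_eq mu_inj).
rewrite /lexlt.
case: (mu s) (mu t) => [s1 s2] [u1 u2]; rewrite xpair_eqE /=; lia.
Qed.

(** After multiplication by [c k] each equation says that a polynomial of degree at most two
    vanishes at [c k], and there are three distinct points. *)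
Lemma three_points (F : fieldType) (c : 'I_3 -> F) (a : 'I_3 -> F) :
  injective c -> (forall i, c i != 0) ->
  (forall k, \sum_i a i * [:: 1; c k; (c k)^-1]`_i = 0) -> forall i, a i = 0.
Proof.
move=> c_inj c0 H; have {H} E k : a 0 + a 1 * c k + a 2 / c k = 0.
  have := H k; rewrite !big_ord_recl big_ord0 /= mulr1 addr0 addrA => <-.
  by congr (_ + a _ * _ + a _ * _); apply: val_inj.
have ne i j : i != j -> c i - c j != 0 by rewrite subr_eq0 (inj_eq c_inj).
have n01 := ne 0 1 isT; have n02 := ne 0 2 isT; have n12 := ne 1 2 isT.
have D j : c 0 - c j != 0 -> a 1 * (c 0 * c j) = a 2.
  move=> n0; apply: (mulfI n0); apply/eqP; rewrite -subr_eq0.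
  have -> : (c 0 - c j) * (a 1 * (c 0 * c j)) - (c 0 - c j) * a 2 =
    c 0 * c j * ((a 0 + a 1 * c 0 + a 2 / c 0) - (a 0 + a 1 * c j + a 2 / c j)).
    by field; rewrite !c0.
  by rewrite !E subr0 mulr0.
have a1 : a 1 = 0.
  have := D 1 n01; rewrite -(D 2 n02) => /eqP; rewrite -subr_eq0 -mulrBr -mulrBr.
  by rewrite !mulf_eq0 (negPf n12) (negPf (c0 0)) !orbF => /eqP.
have a2 : a 2 = 0 by rewrite -(D 1 n01) a1 mul0r.
have a0 : a 0 = 0 by have := E 0; rewrite a1 a2 !mul0r !addr0.
by case=> [[|[|[|//]]] lt_i]; [rewrite -a0|rewrite -a1|rewrite -a2]; congr a; apply: val_inj.
Qed.

Definition tpoly_wf_mx P Q P2 := [&& pmx_wf P, pmx_wf Q & pmx_eq (pmx_mul P Q) P2].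

Section Injectivity.
Variables (R : realType) (F : fieldType) (xi : F) (z : vertex -> F).
Hypotheses (xi_neq0 : xi != 0) (z_neq0 : forall a, z a != 0).
Local Notation V := (int * int -> F^o).
Local Notation K := (E6_base R).
Local Notation J := (@E6_J R).
Local Notation Jinv := (@Jinv R).
Variables (eta : {rmorphism K -> torus R}) (theta : {rmorphism K -> F}).
Variable psi : {rmorphism torus R -> endo V}.
Hypothesis psiZ : forall a k, psi (Z R a k) = qop xi (z a ^ k) (k * tdeg a) (k * sdeg a).
Hypothesis psiq : forall k, psi (q18 k)%:A = qscalar xi (xi ^ k).
Hypothesis eta_central : forall k, central (eta k).
Hypothesis etaX : forall g, eta (pgen _ g) = ev R (E6_image g).
Hypothesis theta_inj : injective theta.
Hypothesis psi_eta : forall k, psi (eta k) = qscalar xi (theta k).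
Variable phi : {rmorphism HE6 R -> 'M[torus R]_3}.
Hypothesis phiC : forall k : K, phi k%:A = (eta k)%:M.
Hypotheses (phi0 : phi (J 0) = evM R pC) (phi1 : phi (J 1) = evM R pY).

Definition eigenval (k : 'I_3) : K :=
  [:: E6_t 0 0 1; E6_t 0 1 1; E6_t 0 0 (-1) * E6_t 0 1 (-1)]`_k.
Definition eigenvalV (k : 'I_3) : K :=
  [:: E6_t 0 0 (-1); E6_t 0 1 (-1); E6_t 0 0 1 * E6_t 0 1 1]`_k.

Lemma E6_tV i j : E6_t i j 1 * E6_t i j (-1) = 1 :> K.
Proof. by rewrite /E6_t /lvar /= !expr1 E6_gen_mulV. Qed.

Lemma eigenval_mulV k : eigenval k * eigenvalV k = 1.
Proof.
case: k => [[|[|[|//]]] ?]; rewrite /eigenval /eigenvalV /= ?E6_tV //.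
by rewrite mulrACA -!(mulrC (E6_t _ _ 1)) !E6_tV mulr1.
Qed.

Lemma eigenval_inj : injective (fun k => theta (eigenval k)).
Proof.
move=> k l /theta_inj.
(* Specializing the two parameters of J_1 to 2 and 3 gives the eigenvalues 2, 3 and 1/6; the factor
   6 below turns them into the distinct integers 12, 18 and 1. *)
pose v (p : E6_param) : R[i] := if p is Pt i j then (if i == 0 then (j.+2)%:R else 1) else 1.
pose g (i : invgen E6_param) := match i with Pos p => v p | Neg p => (v p)^-1 end.
have v0 p : v p != 0.
  by case: p => [|i j]; rewrite /v ?oner_eq0 //; case: ifP; rewrite ?oner_eq0 ?pnatr_eq0.
have [|s t|h [hX _]] := @lift_rmorphism _ _ (@laurent_rel R[i] E6_param) R[i] idfun g.
- by move=> a x; rewrite mulrC.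
- by case=> [{}s {}t|i] /=; rewrite ?mulfV // mulrC.
have hp i j : h (E6_t i j 1) = v (Pt i j) by rewrite /E6_t /lvar /= expr1 hX.
have hn i j : h (E6_t i j (-1)) = (v (Pt i j))^-1 by rewrite /E6_t /lvar /= expr1 hX.
have n2 : (2%:R : R[i]) != 0 by rewrite pnatr_eq0.
have n3 : (3%:R : R[i]) != 0 by rewrite pnatr_eq0.
have e k' : h (eigenval k') * 6%:R = (nth 0%N [:: 12; 18; 1]%N k')%:R.
  case: k' => [[|[|[|//]]] ?]; rewrite /eigenval /= ?rmorphM /= ?hp ?hn /v /=.
  - by rewrite -natrM.
  - by rewrite -natrM.
  - by rewrite -invfM -natrM mulVf // pnatr_eq0.
move=> /(congr1 (fun c => h c * 6%:R)) /eqP; rewrite !e eqr_nat => /eqP kl.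
by apply: val_inj; move: kl; case: k l => [[|[|[|//]]] ?] [[|[|[|//]]] ?].
Qed.

Definition eigen_pow (i k : 'I_3) : K := [:: 1; eigenval k; eigenvalV k]`_i.

Lemma theta_eigen_pow i k :
  theta (eigen_pow i k) = [:: 1; theta (eigenval k); (theta (eigenval k))^-1]`_i.
Proof.
case: i => [[|[|[|//]]] ?]; rewrite /eigen_pow /= ?rmorph1 //.
have := congr1 theta (eigenval_mulV k); rewrite rmorphM rmorph1 => /= E.
have n0 : theta (eigenval k) != 0.
  by apply/eqP => e0; move/eqP: E; rewrite e0 mul0r eq_sym oner_eq0.
by apply: (mulfI n0); rewrite E mulfV.
Qed.

Lemma theta_eigenval_neq0 k : theta (eigenval k) != 0.
Proof.
apply/eqP => e0; have /eqP := congr1 theta (eigenval_mulV k).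
by rewrite rmorphM rmorph1 /= e0 mul0r eq_sym oner_eq0.
Qed.

Definition pDi : pmx := Eval vm_compute in
  pmx_diag (tpoly_mul pc2 pc3) (tpoly_mul pc1 pc3) (tpoly_mul pc1 pc2).

Lemma eta_t i j : eta (E6_t i j 1) = ev R (t_val i j).
Proof. by rewrite /E6_t /lvar /= expr1 etaX. Qed.

Lemma eta_tV i j : eta (E6_t i j (-1)) = ev R (t_inv i j).
Proof. by rewrite /E6_t /lvar /= expr1 etaX. Qed.

Definition eigen_mx (i : 'I_3) : 'M[torus R]_3 := diag_mx (\row_k eta (eigen_pow i k)).

Lemma eigen_mxE i : eigen_mx i = [:: 1; evM R pD; evM R pDi]`_i.
Proof.
have e1 k : eta (eigenval k) = ev R (pmx_entry pD k k).
  case: k => [[|[|[|//]]] ?]; rewrite /eigenval /= ?rmorphM /= ?eta_t ?eta_tV //.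
  by rewrite -ev_mul //; apply: ev_eq; vm_compute.
have e2 k : eta (eigenvalV k) = ev R (pmx_entry pDi k k).
  case: k => [[|[|[|//]]] ?]; rewrite /eigenvalV /= ?rmorphM /= ?eta_t ?eta_tV //.
  by rewrite -ev_mul //; apply: ev_eq; vm_compute.
apply/matrixP => k l; rewrite !mxE /eigen_pow.
have [<-|ne_kl] := eqVneq k l.
  rewrite mulr1n; case: i => [[|[|[|//]]] ?]; rewrite /= ?mxE ?eqxx ?rmorph1 //.
rewrite mulr0n; case: i => [[|[|[|//]]] ?]; rewrite /= ?mxE ?(negPf ne_kl) //.
  by case: k l ne_kl => [[|[|[|//]]] ?] [[|[|[|//]]] ?] //; rewrite /= /ev big_nil.
by case: k l ne_kl => [[|[|[|//]]] ?] [[|[|[|//]]] ?] //; rewrite /= /ev big_nil.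
Qed.

Lemma evMM P Q P' : tpoly_wf_mx P Q P' -> evM R P * evM R Q = evM R P'.
Proof.
by move=> /and3P[wP wQ e]; rewrite -[LHS]/(evM R P *m evM R Q) -evM_mul //; apply: evM_eq.
Qed.

Local Notation cj M := (evM R pGi * M * evM R pG).

Lemma evM1 : evM R (pmx_scal tpoly1) = 1.
Proof. by rewrite evM_scal ev1. Qed.

Lemma G_mulV : evM R pG * evM R pGi = 1.
Proof. by rewrite -evM1; apply: evMM; vm_compute. Qed.

Lemma G_mulVr : evM R pGi * evM R pG = 1.
Proof. by rewrite -evM1; apply: evMM; vm_compute. Qed.

Lemma cjM M N : cj (M * N) = cj M * cj N.
Proof. by rewrite !mulrA -(mulrA _ _ (evM R pGi)) G_mulV mulr1. Qed.

Lemma cjX M n : cj (M ^+ n) = cj M ^+ n.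
Proof. by elim: n => [|n IHn]; rewrite ?expr0 ?mulr1 ?G_mulVr // !exprS cjM IHn. Qed.

Lemma cj_ev P P' : pmx_wf P && pmx_wf (pmx_mul pGi P) && pmx_eq (pconj P) P' ->
  cj (evM R P) = evM R P'.
Proof.
move=> /andP[/andP[wP wGP] e]; rewrite -(evM_eq R e) /pconj evM_mul // evM_mul //.
Qed.

Lemma mul_inv_unique (A : pzRingType) (x y y' : A) : x * y = 1 -> y' * x = 1 -> y' = y.
Proof. by move=> xy yx; rewrite -[y']mulr1 -xy mulrA yx mul1r. Qed.

Lemma phi_J0V : phi (Jinv 0) = evM R pCi.
Proof.
apply: mul_inv_unique (_ : _ * phi (J 0) = 1).
  by rewrite phi0 -evM1; apply: evMM; vm_compute.
by rewrite -rmorphM J_mulVr rmorph1.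
Qed.

Lemma phi_J1V : phi (Jinv 1) = evM R pYi.
Proof.
apply: mul_inv_unique (_ : _ * phi (J 1) = 1).
  by rewrite phi1 -evM1; apply: evMM; vm_compute.
by rewrite -rmorphM J_mulVr rmorph1.
Qed.

Lemma cj_a : cj (phi (J 0)) = evM R ga. Proof. by rewrite phi0; apply: cj_ev; vm_compute. Qed.
Lemma cj_A : cj (phi (Jinv 0)) = evM R gA. Proof. by rewrite phi_J0V; apply: cj_ev; vm_compute. Qed.
Lemma cj_b : cj (phi (J 1)) = evM R gb. Proof. by rewrite phi1; apply: cj_ev; vm_compute. Qed.
Lemma cj_B : cj (phi (Jinv 1)) = evM R gB. Proof. by rewrite phi_J1V; apply: cj_ev; vm_compute. Qed.

Local Notation pow := (tri_pow (J 0) (Jinv 0)).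
Local Notation word := (tri_word (J 0) (Jinv 0) (J 1) (Jinv 1)).

Lemma L_pow i : evM R pL * cj (phi (pow i)) = eigen_mx i * evM R pL.
Proof.
rewrite eigen_mxE; case: i => [[|[|[|//]]] ?]; rewrite /tri_pow /=.
- by rewrite rmorph1 !mulr1 G_mulVr ?mulr1 mul1r.
- by rewrite cj_a; transitivity (evM R (pmx_mul pL ga)); [|symmetry]; apply: evMM; vm_compute.
- by rewrite cj_A; transitivity (evM R (pmx_mul pL gA)); [|symmetry]; apply: evMM; vm_compute.
Qed.

Lemma Rt_pow i : cj (phi (pow i)) * evM R pRt = evM R pRt * eigen_mx i.
Proof.
rewrite eigen_mxE; case: i => [[|[|[|//]]] ?]; rewrite /tri_pow /=.
- by rewrite rmorph1 !mulr1 G_mulVr ?mulr1 mul1r.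
- by rewrite cj_a; transitivity (evM R (pmx_mul ga pRt)); [|symmetry]; apply: evMM; vm_compute.
- by rewrite cj_A; transitivity (evM R (pmx_mul gA pRt)); [|symmetry]; apply: evMM; vm_compute.
Qed.

(* matrix coefficient of [y] between eigenvectors of J_1, applied to a delta function *)
Definition coef (k l : 'I_3) (y : HE6 R) : V :=
  psi ((evM R pL * cj (phi y) * evM R pRt) k l) (delta_vec F l l).

Lemma coefD k l x y : coef k l (x + y) = coef k l x + coef k l y.
Proof. by rewrite /coef rmorphD !(mulrDl, mulrDr) mxE rmorphD. Qed.

Lemma coef0 k l : coef k l 0 = 0.
Proof. by rewrite /coef rmorph0 mulr0 mul0r mulr0 mul0r mxE rmorph0. Qed.

Lemma coef_sum k l (I : finType) (f : I -> HE6 R) : coef k l (\sum_i f i) = \sum_i coef k l (f i).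
Proof. by elim/big_rec2: _ => [|i u v _ <-]; rewrite ?coef0 ?coefD. Qed.

Lemma qscalar_scale c (f : V) : qscalar xi c f = c *: f.
Proof. by apply/funext => x; apply: qscalarE. Qed.

Lemma phiZ c y : phi (c *: y) = (eta c)%:M * phi y.
Proof. by rewrite -[c *: y]mul1r -scalerAr scalerAl rmorphM phiC. Qed.

Lemma L_cjZ c M : evM R pL * cj ((eta c)%:M * M) = (eta c)%:M * (evM R pL * cj M).
Proof.
have sC (N : 'M[torus R]_3) : (eta c)%:M * N = N * (eta c)%:M by apply: scalar_mx_central.
by rewrite !mulrA sC -(mulrA (evM R pL) _ (evM R pGi)) sC !mulrA.
Qed.

Lemma coefZ k l c y : coef k l (c *: y) = theta c *: coef k l y.
Proof.
rewrite /coef phiZ L_cjZ -qscalar_scale -psi_eta -endo_mulE -rmorphM -(mulrA (eta c)%:M).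
congr (endo_fun (psi _) _).
by rewrite -[(eta c)%:M * _]/(_ *m _) mul_scalar_mx mxE.
Qed.

Lemma coef_pow k l i j y :
  coef k l (pow i * y * pow j) = (theta (eigen_pow i k) * theta (eigen_pow j l)) *: coef k l y.
Proof.
rewrite /coef !rmorphM /= !cjM.
have -> : evM R pL * (cj (phi (pow i)) * cj (phi y) * cj (phi (pow j))) * evM R pRt =
    eigen_mx i * (evM R pL * cj (phi y) * evM R pRt) * eigen_mx j.
  by rewrite -!(mulrA _ _ (eigen_mx j)) -Rt_pow !mulrA -L_pow !mulrA.
move: (_ * evM R pRt) => M.
rewrite -[_ * eigen_mx j]/((eigen_mx i *m M) *m diag_mx _) mul_mx_diag mxE.
rewrite mul_diag_mx !mxE !rmorphM /= !psi_eta ?endo_mulE !qscalar_scale !endoZ.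
by rewrite scalerA.
Qed.

Lemma coef_pow1 k l i : coef k l (pow i) = theta (eigen_pow i k) *: coef k l 1.
Proof.
have := coef_pow k l i 0 1; rewrite /= [X in _ * _ * X]/tri_pow /= !mulr1 => ->.
by rewrite /eigen_pow /= rmorph1 mulr1.
Qed.

Lemma coef1 k l : vanish (lexlt 0) (coef k l 1).
Proof.
rewrite /coef rmorph1 mulr1 G_mulVr mulr1 -act_delta.
exact: (vanish_id xi_neq0 z_neq0 psiZ psiq).
Qed.

Definition word_deg (s : bool) (m n : nat) : int * int :=
  if s then (3%:Z, 6%:Z) *+ n + (3%:Z, 3%:Z) *+ m + (3%:Z, 3%:Z)
  else (3%:Z, 6%:Z) *+ n + (3%:Z, 6%:Z) + (0%:Z, 3%:Z) *+ m.

Lemma coef_word k l s m n : lead (coef k l (word s m n)) (word_deg s m n).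
Proof.
rewrite /coef -act_delta /tri_word !rmorphM !rmorphXn !rmorphM /= !cjM !cjX !cjM.
rewrite cj_a cj_A cj_b cj_B /word_deg.
have -> : evM R ga * evM R gB = evM R gaB by apply: evMM; vm_compute.
case: s; rewrite ?cj_b ?cj_B.
(* Regrouping (b A)^m b as b (A b)^m keeps the first component dominant up to the last factor. *)
- have -> : (evM R gb * evM R gA) ^+ m * evM R gb = evM R gb * evM R gAb ^+ m.
    elim: m => [|m IHm]; first by rewrite !expr0 mul1r mulr1.
    rewrite exprS -mulrA IHm exprS !mulrA; congr (_ * _).
    by rewrite -!mulrA; congr (_ * _); apply: evMM; vm_compute.
  rewrite !mulrA; have -> : evM R pL * evM R gb = evM R gLb by apply: evMM; vm_compute.
  exact: (lead_word_b xi_neq0 z_neq0 psiZ psiq).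
- have -> : evM R gb * evM R gA = evM R gbA by apply: evMM; vm_compute.
  rewrite !mulrA; exact: (lead_word_B xi_neq0 z_neq0 psiZ psiq).
Qed.

Lemma phi_inj : injective phi.
Proof.
apply: raddf_inj => y; have [d [k0 [k ->]]] := HE6_sum y => y0.
have k_eq0 w i j : k w i j = 0.
  apply: theta_inj; rewrite rmorph0.
  pose mu (w : bool * ('I_d * 'I_d)) := word_deg w.1 w.2.1 w.2.2.
  have mu_eq s m n : word_deg s m n =
      if s then (3 * (m + n + 1)%:Z, 3 * (m + 2 * n + 1)%:Z)
      else (3 * (n + 1)%:Z, 3 * (m + 2 * n + 2)%:Z).
    have E (p : int * int) e : p *+ e = (p.1 * e%:Z, p.2 * e%:Z).
      elim: e => [|e IHe]; first by rewrite mulr0n !mulr0.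
      by rewrite mulrS IHe intS !mulrDr !mulr1.
    rewrite /word_deg !E; case: s; congr pair => /=; lia.
  (* Twice the first coordinate minus the second is 3 (m + 1) on words with central letter b and -3
     m on those with B. The ray through (1, 2) thus separates the two families, and within each one
     both exponents are linear in the point. *)
  have mu_inj : injective mu.
    move=> [s1 [m1 n1]] [s2 [m2 n2]]; rewrite /mu /= !mu_eq => e.
    suff [-> [em en]] : s1 = s2 /\ (m1 = m2 :> nat /\ n1 = n2 :> nat).
      by rewrite (val_inj em) (val_inj en).
    by move: e; case: s1 s2 => [] [] [] /= *; split; try split => //; lia.
  have mu_gt0 w' : lexlt 0 (mu w').
    by case: w' => [s [m n]]; rewrite /mu /lexlt /= mu_eq; case: s => /=; apply/orP; left; lia.
  pose c k' l' w' := \sum_i \sum_j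
    theta (k w' i j) * (theta (eigen_pow i k') * theta (eigen_pow j l')).
  have c0 k' l' w' : c k' l' w' = 0.
    move: w'; refine (lead_indep (T := (bool * ('I_d * 'I_d))%type) (c := c k' l')
      (g := fun w' : bool * ('I_d * 'I_d) => coef k' l' (word w'.1 w'.2.1 w'.2.2))
      (e := coef k' l' (\sum_i k0 i *: pow i)) mu_inj _ mu_gt0 _ _).
    - by move=> w'; apply: coef_word.
    - rewrite coef_sum; elim/big_rec: _ => [|i' f _ f0] //; apply: vanishD f0 => x x0.
      by rewrite coefZ coef_pow1 fctE /= -[LHS]/(_ * (_ * coef _ _ 1 x)) coef1 // !mulr0.
    - move=> x.
      have coef_y : coef k' l' (\sum_i k0 i *: pow i) x + coef k' l' (\sum_w \sum_i \sum_j
          k w i j *: (pow i * word w.1 w.2.1 w.2.2 * pow j)) x = 0.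
        rewrite -[LHS]/((coef _ _ _ + coef _ _ _) x) -coefD /coef y0.
        by rewrite !(mulr0, mul0r) mxE rmorph0.
      rewrite -[RHS]coef_y; congr (_ + _); rewrite coef_sum fct_sumE.
      apply: eq_bigr => w' _; rewrite /c coef_sum fct_sumE mulr_suml.
      apply: eq_bigr => i' _.
      rewrite coef_sum fct_sumE mulr_suml; apply: eq_bigr => j' _.
      by rewrite coefZ coef_pow scalerA.
  have inj := eigenval_inj; have n0 := theta_eigenval_neq0.
  (* The exponents of J_1 to the right and to the left of the word are separated in turn, by the
     eigenvalues for [l'] and for [k']. *)
  apply: (three_points (a := fun j => theta (k w i j)) inj n0) => l'.
  rewrite (three_points (a := fun i => \sum_j theta (k w i j) *
    [:: 1; theta (eigenval l'); (theta (eigenval l'))^-1]`_j) inj n0) // => k'.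
  rewrite -[RHS](c0 k' l' w); apply: eq_bigr => i' _; rewrite mulr_suml.
  apply: eq_bigr => j' _; rewrite !theta_eigen_pow -mulrA; congr (_ * _); exact: mulrC.
suff k0_eq0 i : k0 i = 0.
  rewrite !big1 ?addr0 // => [w _|i _]; last by rewrite k0_eq0 scale0r.
  by rewrite big1 // => i _; rewrite big1 // => j _; rewrite k_eq0 scale0r.
apply: theta_inj; rewrite rmorph0.
apply: (three_points (a := fun i => theta (k0 i)) eigenval_inj theta_eigenval_neq0) => k'.
have y00 : phi (\sum_i k0 i *: pow i) = 0.
  rewrite -y0; congr (phi _); rewrite [X in _ + X]big1 ?addr0 // => w _.
  by rewrite big1 // => i' _; rewrite big1 // => j _; rewrite k_eq0 scale0r.
(* For powers of J_1 alone the left eigenvectors are enough: the delta function in the third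
   component is dominant there, so no row of [pL] annihilates it. *)
have [_ lead_L] := lead_step_L xi_neq0 z_neq0 psiZ psiq k' (dom3_delta F).
rewrite act_delta in lead_L.
set f := psi _ _ in lead_L.
have sum0 : \sum_i (theta (k0 i) * theta (eigen_pow i k')) *: f = 0.
  transitivity (psi ((evM R pL * cj (phi (\sum_i k0 i *: pow i))) k' 2) (delta_vec F 2 2)).
    rewrite rmorph_sum !(mulr_sumr, mulr_suml) summxE rmorph_sum.
    rewrite (_ : forall h : 'I_3 -> endo V, (\sum_i h i) (delta_vec F 2 2) =
      \sum_i h i (delta_vec F 2 2)); last first.
      by move=> h; elim/big_rec2: _ => // i' u v _ <-.
    apply: eq_bigr => i' _; rewrite phiZ L_cjZ L_pow.
    rewrite -[(eta _)%:M * _]/(_ *m _) mul_scalar_mx mxE -[eigen_mx i' * _]/(_ *m _).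
    rewrite mul_diag_mx !mxE !rmorphM /= !psi_eta ?endo_mulE !qscalar_scale.
    by rewrite scalerA /f mxE.
  by rewrite y00 !(mulr0, mul0r) mxE rmorph0.
apply: (mulIf lead_L); rewrite mul0r mulr_suml.
have := congr1 (fun h : V => h 0) sum0; rewrite fct_sumE -[RHS]/(0 : F) => E.
rewrite -[RHS]E; apply: eq_bigr => i' _.
by rewrite -theta_eigen_pow.
Qed.

End Injectivity.

(** * The homomorphism and the final assembly *)

Definition E6_J_image (i : 'I_3) : pmx := nth [::] [:: pC; pY; pR] i.

Lemma E6_hecke_image i : pmx_eq (pcubic (E6_J_image i) (t_val i 0) (t_val i 1)
  (tpoly_mul (t_inv i 0) (t_inv i 1))) [::].
Proof. by case: i => [[|[|[|//]]] ?]; vm_compute. Qed.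

Lemma evM0 (R : realType) : evM R [::] = 0.
Proof.
by apply/matrixP => i j; rewrite !mxE /pmx_entry nth_nil nth_nil /ev big_nil.
Qed.

Lemma pcubicE (R : realType) P x y z :
  pmx_wf P && pmx_wf (pmx_sub P (pmx_scal x)) && pmx_wf (pmx_sub P (pmx_scal y)) &&
  pmx_wf (pmx_sub P (pmx_scal z)) &&
  pmx_wf (pmx_mul (pmx_sub P (pmx_scal x)) (pmx_sub P (pmx_scal y))) ->
  evM R (pcubic P x y z) =
  (evM R P - (ev R x)%:M) *m (evM R P - (ev R y)%:M) *m (evM R P - (ev R z)%:M).
Proof.
by move=> /andP[/andP[/andP[/andP[_ w1] w2] w3] w4]; rewrite /pcubic !evM_mul // !evM_sub !evM_scal.
Qed.

Lemma HE6_morph (R : realType) (eta : {rmorphism E6_base R -> torus R}) :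
  (forall k, central (eta k)) -> (forall g, eta (pgen _ g) = ev R (E6_image g)) ->
  exists phi : {rmorphism HE6 R -> 'M[torus R]_3},
    (forall i, phi (E6_J R i) = evM R (E6_J_image i)) /\
    (forall k : E6_base R, phi k%:A = (eta k)%:M).
Proof.
move=> etaZ etaX.
pose f : {rmorphism E6_base R -> 'M[torus R]_3} := @scalar_mx (torus R) 3 \o eta.
have [|s t|phi [phiJ phiC]] := @lift_rmorphism _ _ (@E6_rel R) _ f (fun i => evM R (E6_J_image i)).
- by move=> k M /=; apply: scalar_mx_central.
- case=> [i|] /=.
  + have := evM_eq R (E6_hecke_image i); rewrite evM0 pcubicE; last first.
      by case: i => [[|[|[|//]]] ?]; vm_compute.
    rewrite !rmorphN1 !mulN1r rmorph0 => H.
    have -> : (0 : torus R)%:M = 0 :> 'M_3 by exact: raddf0.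
    rewrite -[RHS]H (eta_t etaX) (eta_t etaX) rmorphM /= (eta_tV etaX) (eta_tV etaX) ev_mul //.
      by case: i {H} => [[|[|[|//]]] ?].
      by case: i {H} => [[|[|[|//]]] ?].
  (* The relation involves q^{-1/3}, the inverse generator, whose image is q^{2/3}. *)
  + rewrite /E6_q3 /lvar /= expr1 etaX -evM_scal.
    rewrite (@evMM R pC pY (pmx_mul pC pY)); last by vm_compute.
    by apply: evMM; vm_compute.
- by exists phi; split.
Qed.

Theorem theorem1p2 (R : realType) :
  let C := Cbar R in
  let Y := Ybar R in
  (* (i) *)
  [/\ central (c1 R), central (c2 R) & central (c3 R)] /\
  [/\ central (y1 R), central (y2 R) & central (y3 R)] /\
  [/\ central (r1 R), central (r2 R) & central (r3 R)] /\
  (exists C' : 'M[torus R]_3, mx_inverse C C') /\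
  (exists Y' : 'M[torus R]_3, mx_inverse Y Y') /\
  exists2 CYinv : 'M[torus R]_3, mx_inverse (C *m Y) CYinv &
    let Rb : 'M[torus R]_3 := q3 2 *: CYinv in
    (* (ii) *)
    [/\ (C - (c1 R)%:M) *m (C - (c2 R)%:M) *m (C - (c3 R)%:M) = 0,
        (Y - (y1 R)%:M) *m (Y - (y2 R)%:M) *m (Y - (y3 R)%:M) = 0,
        (Rb - (r1 R)%:M) *m (Rb - (r2 R)%:M) *m (Rb - (r3 R)%:M) = 0
      & C *m Y *m Rb = (q3 2)%:M] /\
    (* (iii) *)
    exists phi : {rmorphism HE6 R -> 'M[torus R]_3},
      (forall a : R[i],
         phi (a%:A : E6_base R)%:A = ((a%:A : qring R)%:A : torus R)%:M) /\
      [/\ phi (E6_J R 0) = C, phi (E6_J R 1) = Y & phi (E6_J R 2) = Rb] /\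
      phi (E6_q3 1)%:A = (q3 (-2))%:M /\
      (phi (E6_t 0 0 1)%:A = (c1 R)%:M /\ phi (E6_t 0 1 1)%:A = (c2 R)%:M) /\
      (phi (E6_t 1 0 1)%:A = (y1 R)%:M /\ phi (E6_t 1 1 1)%:A = (y2 R)%:M) /\
      (phi (E6_t 2 0 1)%:A = (r1 R)%:M /\ phi (E6_t 2 1 1)%:A = (r2 R)%:M) /\
      injective phi.
Proof.
move=> C Y.
have ev_mx P Q P' : tpoly_wf_mx P Q P' -> evM R P *m evM R Q = evM R P' by apply: evMM.
have one : evM R (pmx_scal tpoly1) = 1%:M by rewrite evM_scal ev1.
have CCi : C *m evM R pCi = 1%:M by rewrite /C CbarE -one; apply: ev_mx; vm_compute.
have CiC : evM R pCi *m C = 1%:M by rewrite /C CbarE -one; apply: ev_mx; vm_compute.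
have YYi : Y *m evM R pYi = 1%:M by rewrite /Y YbarE -one; apply: ev_mx; vm_compute.
have YiY : evM R pYi *m Y = 1%:M by rewrite /Y YbarE -one; apply: ev_mx; vm_compute.
do 3?[split; first by rewrite ?c1E ?c2E ?c3E ?y1E ?y2E ?y3E ?r1E ?r2E ?r3E;
  split; apply: ev_central; vm_compute].
split; first by exists (evM R pCi).
split; first by exists (evM R pYi).
exists (evM R pYi *m evM R pCi).
  split; first by rewrite -mulmxA (mulmxA Y) YYi mul1mx.
  by rewrite -mulmxA (mulmxA _ C) CiC mul1mx.
have RbE : q3 2 *: (evM R pYi *m evM R pCi) = evM R pR.
  rewrite -mul_scalar_mx -ev_q -evM_scal (ev_mx _ _ (pmx_mul pYi pCi)); last by vm_compute.
  by apply: ev_mx; vm_compute.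
have cub P x y z : pmx_wf P && pmx_wf (pmx_sub P (pmx_scal x)) &&
    pmx_wf (pmx_sub P (pmx_scal y)) && pmx_wf (pmx_sub P (pmx_scal z)) &&
    pmx_wf (pmx_mul (pmx_sub P (pmx_scal x)) (pmx_sub P (pmx_scal y))) ->
    pmx_eq (pcubic P x y z) [::] ->
    (evM R P - (ev R x)%:M) *m (evM R P - (ev R y)%:M) *m (evM R P - (ev R z)%:M) = 0.
  by move=> w /(evM_eq R); rewrite evM0 pcubicE.
split.
  split; rewrite ?RbE.
  - by rewrite /C CbarE c1E c2E c3E; apply: (cub _ _ _ _ _ pC_cubic); vm_compute.
  - by rewrite /Y YbarE y1E y2E y3E; apply: (cub _ _ _ _ _ pY_cubic); vm_compute.
  - by rewrite r1E r2E r3E; apply: (cub _ _ _ _ _ pR_cubic); vm_compute.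
  - rewrite /C /Y CbarE YbarE -ev_q -evM_scal (ev_mx _ _ (pmx_mul pC pY)); last by vm_compute.
    by apply: ev_mx; vm_compute.
have [eta [theta [psi [[etaZ etaC etaX] [psiZ psiq] theta_inj psi_eta]]]] := generic_rep R.
have [phi [phiJ phiC]] := HE6_morph etaZ etaX.
exists phi; split; first by move=> a; rewrite phiC etaC.
split; first by rewrite !phiJ RbE /C /Y CbarE YbarE.
split.
  by rewrite phiC /E6_q3 /lvar /= expr1 etaX -ev_q.
rewrite !phiC !(eta_t etaX) c1E c2E y1E y2E r1E r2E; do 3?split => //.
apply: (phi_inj _ _ psiZ psiq etaZ etaX theta_inj psi_eta phiC (phiJ 0) (phiJ 1)).
- by rewrite invr_eq0 gen_var_neq0.
- exact/z_val_neq0/gen_var_neq0.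
Qed.
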